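(* Let $\mathbb{K}$ be a field, let $L=\{\ell_1,\ldots,\ell_m\}$ be a collection of 2-dimensional subspaces of $\mathbb{K}^n$, let $u_k,v_k$ be a basis of $\ell_k$ for each $k\in[m]$, and let $$A_L=\sum_{k=1}^m (u_kv_k^\top-v_ku_k^\top)x_k .$$ Then $${\cal P}^2(A_L)={\cal P}^{\le2}(A_L)={\cal Q}(A_L).$$
   Context: Notation: $[n]=\{1,\ldots,n\}$. For a matrix $A=\sum_{k=1}^m A_kx_k$ with $A_k\in\mathbb{K}^{n\times n}$ and indeterminates $x_1,\ldots,x_m$, and $I,J\subseteq[n]$, $A[I,J]$ is the submatrix with row index set $I$ and column index set $J$; the determinant of the empty matrix is $1$. For a multivariate polynomial $p$, $\operatorname{supp} p$ denotes the set of exponent vectors of monomials appearing in $p$ with nonzero coefficient. $\operatorname{Conv}$ denotes convex hull. For $d\ge 1$ and $I,J\subseteq[n]$, the blow-up is $A[I,J]^{\{d\}}=\sum_{k=1}^m A_k[I,J]\otimes X_k$, where $X_k=(x_{k,ij})_{i,j\in[d]}$ is a $d\times d$ matrix whose entries $x_{k,ij}$ ($k\in[m]$, $i,j\in[d]$) are distinct commuting indeterminates, and $\otimes$ is the Kronecker product. For $|I|=|J|$, $\operatorname{supp}\det A[I,J]^{\{d\}}$ is a set of integer vectors $z=(z_{k,ij})_{k\in[m],i,j\in[d]}$. For such $z$ define $\operatorname{proj}_d(z)\in\mathbb{Q}^m_{\ge0}$ by $\operatorname{proj}_d(z)_k=\frac1d\sum_{i,j\in[d]}z_{k,ij}$.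 For $d\ge1$ and $\ell\in\{0,\ldots,n\}$ put $${\cal S}^d_\ell=\bigcup_{I,J\subseteq[n]:\,|I|=|J|=\ell}\operatorname{proj}_d(\operatorname{supp}\det A[I,J]^{\{d\}}),$$ and define $${\cal P}^d(A)=\operatorname{Conv}\bigcup_{\ell=0}^n{\cal S}^d_\ell,\quad {\cal P}^{\le d}(A)=\operatorname{Conv}\bigcup_{f=1}^d\bigcup_{\ell=0}^n{\cal S}^f_\ell,\quad {\cal Q}(A)=\operatorname{Conv}\bigcup_{d=1}^\infty\bigcup_{\ell=0}^n{\cal S}^d_\ell .$$ (Changing the basis $u_k,v_k$ of $\ell_k$ changes $u_kv_k^\top-v_ku_k^\top$ only by a nonzero scalar.) *)

(* Defs.v *)
From mathcomp Require Import all_boot all_order all_algebra.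
From mathcomp Require Import classical_sets.
From mathcomp Require Import mxtens mpoly.

Set Implicit Arguments.
Unset Strict Implicit.
Unset Printing Implicit Defensive.

Import GRing.Theory Num.Theory.

Local Open Scope ring_scope.
Local Open Scope classical_set_scope.

(* A linear symbolic matrix [A = \sum_k A_k x_k] is given by its family of
   coefficient matrices [A : 'I_m -> 'M[K]_n]. *)

(* [{mpoly K[N]}] has its variables indexed by ['I_N]; the indeterminate
   [x_{k,ij}] is therefore the variable of index [blowup_var (k, i, j)]. *)
Definition blowup_nvars (m d : nat) : nat := #|{: 'I_m * 'I_d * 'I_d}|.

Definition blowup_var m d (k : 'I_m) (i j : 'I_d) : 'I_(blowup_nvars m d) :=
  enum_rank (k, i, j).

Definition generic_mx (K : fieldType) m d (k : 'I_m) :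
    'M[{mpoly K[blowup_nvars m d]}]_d :=
  \matrix_(i, j) 'X_(blowup_var k i j).

Definition set_submx (K : fieldType) n (M : 'M[K]_n) (I J : {set 'I_n}) :
    'M[K]_(#|I|, #|J|) :=
  mxsub (fun i : 'I_#|I| => enum_val i) (fun j : 'I_#|J| => enum_val j) M.

Definition blowup (K : fieldType) m n (A : 'I_m -> 'M[K]_n)
    (I J : {set 'I_n}) (d : nat) :
    'M[{mpoly K[blowup_nvars m d]}]_(#|I| * d, #|J| * d) :=
  \sum_(k < m)
    tensmx (map_mx (@mpolyC (blowup_nvars m d) K) (set_submx (A k) I J))
           (generic_mx K d k).

(* The cast makes the matrix square, so that the determinant is defined. *)
Definition blowup_det (K : fieldType) m n (A : 'I_m -> 'M[K]_n)
    (I J : {set 'I_n}) (d l : nat) (hI : #|I| = l) (hJ : #|J| = l) :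
    {mpoly K[blowup_nvars m d]} :=
  \det (castmx (congr1 (muln^~ d) hI, congr1 (muln^~ d) hJ) (blowup A I J d)).

Definition blowup_proj (R : realFieldType) m d
    (z : 'X_{1.. blowup_nvars m d}) : 'rV[R]_m :=
  \row_(k < m) (d%:R^-1 * (\sum_(i < d) \sum_(j < d) z (blowup_var k i j))%N%:R).

Definition Sset (R : realFieldType) (K : fieldType) m n
    (A : 'I_m -> 'M[K]_n) (d l : nat) : set 'rV[R]_m :=
  [set p | exists (I J : {set 'I_n}) (hI : #|I| = l) (hJ : #|J| = l),
     exists2 z, z \in msupp (blowup_det A d hI hJ) & p = blowup_proj R z].

Arguments Sset R {K m n} A d l.

Definition conv (R : realFieldType) m (S : set 'rV[R]_m) : set 'rV[R]_m :=
  [set x | exists (N : nat) (w : 'I_N -> R) (p : 'I_N -> 'rV[R]_m),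
     [/\ forall i, 0 <= w i, \sum_(i < N) w i = 1, forall i, S (p i)
       & x = \sum_(i < N) w i *: p i]].

Definition Pd (R : realFieldType) (K : fieldType) m n
    (A : 'I_m -> 'M[K]_n) (d : nat) : set 'rV[R]_m :=
  conv (\bigcup_(l in [set l | (l <= n)%N]) Sset R A d l).

Arguments Pd R {K m n} A d.

Definition Ple (R : realFieldType) (K : fieldType) m n
    (A : 'I_m -> 'M[K]_n) (d : nat) : set 'rV[R]_m :=
  conv (\bigcup_(f in [set f | (1 <= f <= d)%N])
          \bigcup_(l in [set l | (l <= n)%N]) Sset R A f l).

Arguments Ple R {K m n} A d.

Definition Qset (R : realFieldType) (K : fieldType) m n
    (A : 'I_m -> 'M[K]_n) : set 'rV[R]_m :=
  conv (\bigcup_(d in [set d | (1 <= d)%N])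
          \bigcup_(l in [set l | (l <= n)%N]) Sset R A d l).

Arguments Qset R {K m n} A.

Definition line_mx (K : fieldType) m n (u v : 'I_m -> 'cV[K]_n) :
    'I_m -> 'M[K]_n :=
  fun k => u k *m (v k)^T - v k *m (u k)^T.

(* Main.v *)
Require Import Defs.
From mathcomp Require Import all_boot all_order all_algebra.
From mathcomp Require Import classical_sets.
From mathcomp Require Import mxtens mpoly.
From mathcomp Require Import perm boolp zify ring lra.

Set Implicit Arguments.
Unset Strict Implicit.
Unset Printing Implicit Defensive.

Import Order.TTheory GRing.Theory Num.Theory.

Local Open Scope ring_scope.

(** Let [L_k] be the plane spanned by [u_k] and [v_k].  The three hulls are
    equal to one polytope, [line_polytope]: the set of the [p >= 0] such that
    [\sum_k \rank (S :&: L_k) * p_k <= 2 * \rank S] for every subspace [S].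

    Exponents of every blow-up satisfy these inequalities
    ([blowup_degree_bound]).  In coordinates in which [S] is spanned by the
    first basis vectors, the entry [(i, j)] of [u_k^T v_k - v_k^T u_k] is zero
    unless at least [\rank (S :&: L_k)] of the indices [i], [j] are among the
    first [\rank S]; in a term of the Leibniz formula every row and every
    column is used once, which bounds the weighted degree.

    Conversely, a point of the polytope is a convex combination of extreme
    points ([line_polytope_ind]), and every extreme point [p] is an exponent of
    the second blow-up ([extreme_exponent]), for the following reason.  By
    submodularity the tight subspaces form a lattice, on which the dimensions
    [\rank (S :&: L_k)], [p_k <> 0], are modular.  Hence a chain of tight
    subspaces that cannot be refined has the same linear consequences as all
    the tight subspaces ([step_inj]), and these determine [p].  The lines
    [L_k] with [p_k <> 0] are the edges of a graph whose vertices are the steps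
    of the chain, and the values [p_k] at a vertex add up to twice the
    dimension gained at that step, which is an even integer.  A vertex
    therefore cannot meet exactly one end of an edge whose value is not an
    even integer; counting vertices and edges, and using that the values are
    determined by their sums, one finds that these edges form a 2-regular
    graph and have value 1.  All the other values are 0 or 2, and every step
    has dimension 1 ([extreme_structure]).

    In a basis adapted to this flag, the lowest-weight component of the
    determinant of the second blow-up is the determinant of the blow-up of the
    Tutte matrix of the graph ([graph_component]).  Its monomials have degree
    4 at each vertex, so their exponent satisfies the equations that determine
    [p].  It is nonzero ([graph_det_neq0]): substitute the identity for the
    matrix [X_k] of an edge of value 2, and a matrix of rank one [b_k^T b_k]
    for an edge of value 1, the row vectors [b_k] being pairwise independent
    in dimension 2.  A vector of the kernel has a component of dimension 2 at
    each vertex, and this component is killed by the identity or orthogonal to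
    two independent [b_k].
    Two is the least size for which this works: the Tutte matrix of an odd
    cycle is singular. *)

(** * Weights of monomials *)

Section Weights.

Variables (R : realFieldType) (K : fieldType) (nv : nat) (w : 'I_nv -> R).

Definition mnm_weight (z : 'X_{1..nv}) : R := \sum_i w i * (z i)%:R.

Definition weight_ge (c : R) (f : {mpoly K[nv]}) : Prop :=
  forall z, z \in msupp f -> c <= mnm_weight z.

Lemma mnm_weightD z1 z2 :
  mnm_weight (z1 + z2)%MM = mnm_weight z1 + mnm_weight z2.
Proof.
rewrite /mnm_weight -big_split; apply: eq_bigr => i _.
by rewrite mnmDE natrD mulrDr.
Qed.

Lemma mnm_weight1 i : mnm_weight U_(i)%MM = w i.
Proof.
rewrite /mnm_weight (bigD1 i) //= big1 ?addr0 => [|j ji].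
  by rewrite mnm1E eqxx mulr1.
by rewrite mnm1E eq_sym (negbTE ji) mulr0.
Qed.

Lemma weight_geW c c' f : c' <= c -> weight_ge c f -> weight_ge c' f.
Proof. by move=> cc' fc z /fc; apply: le_trans. Qed.

Lemma weight_ge0 c : weight_ge c 0.
Proof. by move=> z; rewrite msupp0. Qed.

Lemma weight_geD c f g : weight_ge c f -> weight_ge c g -> weight_ge c (f + g).
Proof.
by move=> fc gc z /msuppD_le; rewrite mem_cat => /orP[/fc|/gc].
Qed.

Lemma weight_geN c f : weight_ge c f -> weight_ge c (- f).
Proof. by move=> fc z; rewrite (perm_mem (msuppN f)) => /fc. Qed.

Lemma weight_ge_sum (I : Type) (r : seq I) (P : pred I) c F :
  (forall i, P i -> weight_ge c (F i)) -> weight_ge c (\sum_(i <- r | P i) F i).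
Proof.
by move=> Fc; elim/big_ind: _ => //; [exact: weight_ge0|exact: weight_geD].
Qed.

Lemma weight_geM c d f g :
  weight_ge c f -> weight_ge d g -> weight_ge (c + d) (f * g).
Proof.
move=> fc gd z /msuppM_le /allpairsP[[z1 z2] /= [z1f z2g ->]].
by rewrite mnm_weightD lerD ?fc ?gd.
Qed.

Lemma weight_geC c : weight_ge 0 c%:MP.
Proof.
move=> z; rewrite msuppC; case: ifP => // _; rewrite inE => /eqP ->.
by rewrite /mnm_weight big1 // => i _; rewrite mnm0E mulr0.
Qed.

Lemma weight_ge_term c i : weight_ge (w i) (c%:MP * 'X_i).
Proof.
rewrite -[w i]add0r; apply: weight_geM; first exact: weight_geC.
by move=> z; rewrite msuppX inE => /eqP ->; rewrite mnm_weight1.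
Qed.

(** Changing the factors one at a time, each change is multiplied by the other
    factors, whose bounds add up. *)
Lemma weight_ge_prod_diff (I : Type) (r : seq I) (c : I -> R) (e : R)
    (F G : I -> {mpoly K[nv]}) : 0 <= e ->
    (forall i, weight_ge (c i) (F i)) ->
    (forall i, weight_ge (c i + e) (F i - G i)) ->
  [/\ weight_ge (\sum_(i <- r) c i) (\prod_(i <- r) F i)
    , weight_ge (\sum_(i <- r) c i) (\prod_(i <- r) G i)
    & weight_ge (\sum_(i <- r) c i + e)
        (\prod_(i <- r) F i - \prod_(i <- r) G i)].
Proof.
move=> e0 Fc FGc; elim/big_rec3: _ => [|i s g f _ [sf sg sfg]].
  rewrite subrr; split; [exact: weight_geC|exact: weight_geC|exact: weight_ge0].
have Gc : weight_ge (c i) (G i).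
  rewrite -[G i](subKr (F i)); apply: weight_geD => //; apply: weight_geN.
  by apply: weight_geW (FGc i); rewrite lerDl.
split; [exact: weight_geM|exact: weight_geM|].
rewrite (_ : _ - _ = (F i - G i) * f + G i * (f - g)); last first.
  by rewrite mulrBl mulrBr addrA subrK.
apply: weight_geD; last by rewrite -addrA; apply: weight_geM.
by rewrite addrAC; apply: weight_geM.
Qed.

(** All the terms of the Leibniz formula have the same weight bound, since a
    permutation uses every row and every column once. *)
Lemma weight_ge_det_diff N (row col : 'I_N -> R) (e : R)
    (F G : 'M[{mpoly K[nv]}]_N) : 0 <= e ->
    (forall i j, weight_ge (row i + col j) (F i j)) ->
    (forall i j, weight_ge (row i + col j + e) (F i j - G i j)) ->
  weight_ge (\sum_i row i + \sum_i col i + e) (\det F - \det G).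
Proof.
move=> e0 Fc FGc; rewrite /determinant -sumrB.
apply: weight_ge_sum => s _; rewrite -mulrBr.
rewrite [X in _ + X + e](reindex_inj (@perm_inj _ s)) /= -big_split /=.
have [_ _ FG] := weight_ge_prod_diff (index_enum 'I_N) e0
  (fun i => Fc i (s i)) (fun i => FGc i (s i)).
by rewrite mulr_sign; case: (odd_perm s) => //; apply: weight_geN.
Qed.

Lemma weight_ge_det N (row col : 'I_N -> R) (F : 'M[{mpoly K[nv]}]_N) :
    (forall i j, weight_ge (row i + col j) (F i j)) ->
  weight_ge (\sum_i row i + \sum_i col i) (\det F).
Proof.
move=> Fc; rewrite /determinant; apply: weight_ge_sum => s _.
rewrite [X in _ + X](reindex_inj (@perm_inj _ s)) /= -big_split /=.
have FF i : weight_ge (row i + col (s i) + 0) (F i (s i) - F i (s i)).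
  by rewrite subrr; apply: weight_ge0.
have [FG _ _] := weight_ge_prod_diff (index_enum 'I_N) (lexx 0)
  (fun i => Fc i (s i)) FF.
by rewrite mulr_sign; case: (odd_perm s) => //; apply: weight_geN.
Qed.

End Weights.

(** * Blow-ups of families of square matrices *)

Section Blowup.

Variables (R : realFieldType) (K : fieldType) (m l d : nat).
Implicit Types (A B : 'I_m -> 'M[K]_l) (z : 'X_{1..blowup_nvars m d}).

Definition blowup_mx A : 'M[{mpoly K[blowup_nvars m d]}]_(l * d) :=
  \sum_k tensmx (map_mx (@mpolyC _ K) (A k)) (generic_mx K d k).

Lemma blowup_mxE A p q :
  blowup_mx A p q = \sum_k
    (A k (mxtens_unindex p).1 (mxtens_unindex q).1)%:MP *
    'X_(blowup_var k (mxtens_unindex p).2 (mxtens_unindex q).2).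
Proof. by rewrite summxE; apply: eq_bigr => k _; rewrite !mxE. Qed.

(** Weights that are constant on each generic matrix [X_k] suffice, because
    only the total degrees in these matrices are recorded by [blowup_proj]. *)
Definition block_weight (w : 'I_m -> R) (i : 'I_(blowup_nvars m d)) : R :=
  w (enum_val i).1.1.

Definition block_degree z (k : 'I_m) : R :=
  (\sum_(i < d) \sum_(j < d) z (blowup_var k i j))%N%:R.

Lemma block_weightE w z :
  mnm_weight (block_weight w) z = \sum_k w k * block_degree z k.
Proof.
rewrite /mnm_weight (reindex (@enum_rank ('I_m * 'I_d * 'I_d)%type)) /=; last first.
  by exists enum_val => x _; rewrite (enum_rankK, enum_valK).
under eq_bigr do rewrite /block_weight enum_rankK.
transitivity (\sum_k \sum_i \sum_j w k * (z (blowup_var k i j))%:R); last first.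
  apply: eq_bigr => k _; rewrite /block_degree natr_sum mulr_sumr.
  by apply: eq_bigr => i _; rewrite natr_sum mulr_sumr.
by rewrite !pair_bigA; apply: eq_bigr => -[[k i] j] _.
Qed.

Lemma sum_mxtens_row (row : 'I_l -> R) :
  \sum_(p < l * d) row (mxtens_unindex p).1 = d%:R * \sum_i row i.
Proof.
rewrite (reindex (@mxtens_index l d)); last first.
  by exists (@mxtens_unindex l d) => x _; rewrite (mxtens_indexK, mxtens_unindexK).
rewrite (eq_bigr (fun p => row p.1)) => [|p _]; last by rewrite mxtens_indexK.
rewrite -(pair_bigA _ (fun i (_ : 'I_d) => row i)) /= mulr_sumr.
by apply: eq_bigr => i _; rewrite sumr_const card_ord mulr_natl.
Qed.

(** The levels [row] and [col] are counted [d] times because each index of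
    the family is repeated [d] times in its blow-up. *)
Lemma weight_ge_blowup_det (w : 'I_m -> R) (row col : 'I_l -> R) A :
    (forall k i j, A k i j != 0 -> row i + col j <= w k) ->
  weight_ge (block_weight w) (d%:R * (\sum_i row i + \sum_i col i))
    (\det (blowup_mx A)).
Proof.
move=> Aw; rewrite mulrDr -!sum_mxtens_row.
apply: weight_ge_det => p q; rewrite blowup_mxE; apply: weight_ge_sum => k _.
have [->|/Aw le_w] := eqVneq (A k (mxtens_unindex p).1 (mxtens_unindex q).1) 0.
  by rewrite mul0r; apply: weight_ge0.
refine (weight_geW le_w _).
rewrite (_ : w k = block_weight w
  (blowup_var k (mxtens_unindex p).2 (mxtens_unindex q).2)).
  exact: weight_ge_term.
by rewrite /block_weight /blowup_var enum_rankK.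
Qed.

Lemma weight_ge_blowup_det_diff (w : 'I_m -> R) (row col : 'I_l -> R) A B :
    (forall k i j, A k i j != 0 -> row i + col j <= w k) ->
    (forall k i j, A k i j != B k i j -> row i + col j + 1 <= w k) ->
  weight_ge (block_weight w) (d%:R * (\sum_i row i + \sum_i col i) + 1)
    (\det (blowup_mx A) - \det (blowup_mx B)).
Proof.
move=> Aw ABw; rewrite mulrDr -!sum_mxtens_row.
have wE k a b : w k = block_weight w (blowup_var k a b).
  by rewrite /block_weight /blowup_var enum_rankK.
apply: weight_ge_det_diff => // p q.
  rewrite blowup_mxE; apply: weight_ge_sum => k _.
  have [->|/Aw le_w] := eqVneq (A k (mxtens_unindex p).1 (mxtens_unindex q).1) 0.
    by rewrite mul0r; apply: weight_ge0.
  apply: weight_geW le_w _; rewrite (wE k (mxtens_unindex p).2 (mxtens_unindex q).2).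
  exact: weight_ge_term.
rewrite !blowup_mxE -sumrB; apply: weight_ge_sum => k _.
rewrite -mulrBl -rmorphB.
have [->|/ABw le_w] := eqVneq (A k (mxtens_unindex p).1 (mxtens_unindex q).1)
  (B k (mxtens_unindex p).1 (mxtens_unindex q).1).
  by rewrite subrr mul0r; apply: weight_ge0.
apply: weight_geW le_w _; rewrite (wE k (mxtens_unindex p).2 (mxtens_unindex q).2).
exact: weight_ge_term.
Qed.

Lemma tensmx11 : tensmx 1%:M 1%:M = 1%:M :> 'M[K]_(l * d).
Proof.
apply/matrixP => p q; case: (mxtens_indexP p) => i a; case: (mxtens_indexP q) => j b.
by rewrite tensmxE !mxE (can_eq (@mxtens_indexK l d)) xpair_eqE -natrM mulnb.
Qed.

Lemma tensmx1_unit (P : 'M[K]_l) :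
  P \in unitmx -> tensmx P 1%:M \in (unitmx : pred 'M[K]_(l * d)).
Proof.
move=> Pu.
suff /mulmx1_unit[] : tensmx P 1%:M *m tensmx (invmx P) 1%:M = 1%:M :> 'M_(l * d) by [].
by rewrite tensmx_mul mulmxV // mulmx1 tensmx11.
Qed.

(** A change of basis in [K^l] acts on the blow-up through its Kronecker
    product with the identity, and multiplies the determinant by a constant. *)
Lemma msupp_blowup_conj A P Q : P \in unitmx -> Q \in unitmx ->
  msupp (\det (blowup_mx (fun k => P *m A k *m Q))) =i
  msupp (\det (blowup_mx A)).
Proof.
move=> Pu Qu.
have -> : blowup_mx (fun k => P *m A k *m Q) =
    map_mx (@mpolyC _ K) (tensmx P 1%:M) *m blowup_mx A *m
    map_mx (@mpolyC _ K) (tensmx Q 1%:M).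
  rewrite /blowup_mx mulmx_sumr mulmx_suml; apply: eq_bigr => k _.
  by rewrite !map_mxT !tensmx_mul !map_mxM map_mx1 mul1mx mulmx1.
rewrite !det_mulmx !det_map_mx => z; rewrite mulrAC -rmorphM /=.
rewrite !mcoeff_msupp mcoeffCM mulf_eq0 negb_or.
by rewrite mulf_neq0 // -unitfE -unitmxE tensmx1_unit.
Qed.

End Blowup.

(** * Rank-two alternating matrices *)

Section Alternating.

Variables (K : fieldType) (n : nat).
Implicit Types (u v w : 'rV[K]_n) (S T : 'M[K]_n).

Definition alt_mx u v : 'M[K]_n := u^T *m v - v^T *m u.

Lemma alt_mxE u v i j : alt_mx u v i j = u 0 i * v 0 j - v 0 i * u 0 j.
Proof. by rewrite !mxE !big_ord1 !mxE. Qed.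

(** A change of basis of the plane scales the alternating matrix by the
    determinant of the change; here only one new basis vector is imposed. *)
Lemma alt_mx_adapt u v w : (w <= u + v)%MS -> w != 0 ->
  exists w' c, [/\ c != 0, alt_mx u v = c *: alt_mx w w',
    (w' <= u + v)%MS & (u + v <= w + w')%MS].
Proof.
case/sub_addsmxP => -[D1 D2] /= ->; rewrite (mx11_scalar D1) (mx11_scalar D2).
rewrite !mul_scalar_mx; move: (D1 0 0) (D2 0 0) => a b.
have [->|a0 _] := eqVneq a 0; last first.
  exists v, a^-1; rewrite invr_eq0 a0; split=> //.
  - by apply/matrixP => i j; rewrite [RHS]mxE !alt_mxE !mxE; field.
  - exact: addsmxSr.
  rewrite addsmx_sub addsmxSr andbT.
  apply/sub_addsmxP; exists ((a^-1)%:M, (- (a^-1 * b))%:M) => /=.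
  by rewrite !mul_scalar_mx scalerDr !scalerA mulVf // scale1r scaleNr addrK.
rewrite scale0r add0r => bv0.
have b0 : b != 0 by apply: contraNneq bv0 => ->; rewrite scale0r.
exists u, (- b^-1); rewrite oppr_eq0 invr_eq0 b0; split=> //.
- by apply/matrixP => i j; rewrite [RHS]mxE !alt_mxE !mxE; field.
- exact: addsmxSl.
rewrite addsmx_sub addsmxSr /=.
apply: submx_trans (addsmxSl _ _).
by apply/sub_rVP; exists b^-1; rewrite scalerA mulVf // scale1r.
Qed.

Lemma capmx_neq0 S T : (0 < \rank (S :&: T))%N ->
  exists w : 'rV_n, [/\ w != 0, (w <= S)%MS & (w <= T)%MS].
Proof.
rewrite lt0n mxrank_eq0 => /rowV0Pn[w]; rewrite sub_capmx => /andP[wS wT] w0.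
by exists w.
Qed.

Lemma rank_addsmx_rV u v : (\rank (u + v) <= 2)%N.
Proof.
apply: leq_trans (mxrank_adds_leqif u v) _.
exact: leq_add (rank_leq_row u) (rank_leq_row v).
Qed.

End Alternating.

(** * The bound on the exponents of a blow-up determinant *)

Section NewtonBound.

Variables (K : fieldType) (m n : nat) (u v : 'I_m -> 'rV[K]_n).

Definition line_rank (S : 'M[K]_n) (k : 'I_m) : nat :=
  \rank (S :&: (u k + v k))%MS.

Lemma line_rank_le2 S k : (line_rank S k <= 2)%N.
Proof. by apply: leq_trans (rank_addsmx_rV (u k) (v k)); rewrite mxrankS ?capmxSr. Qed.

Lemma line_rank2_sub S k : line_rank S k = 2 -> (u k + v k <= S)%MS.
Proof.
move=> q2; apply: submx_trans (capmxSl S (u k + v k)%MS).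
rewrite -(geq_leqif (mxrank_leqif_sup (capmxSr S (u k + v k)%MS))).
by rewrite -/(line_rank S k) q2 rank_addsmx_rV.
Qed.

Section Columns.

Variables (l : nat) (f : 'I_l -> 'I_n) (S : 'M[K]_n).

(** Coordinates of [K^l] in which the projection of [S] is spanned by the
    first basis vectors. *)
Definition straighten : 'M[K]_l := invmx (row_ebase (colsub f S)).

Lemma straighten_unit : straighten \in unitmx.
Proof. by rewrite unitmx_inv row_ebase_unit. Qed.

Lemma straightenP (w : 'rV_n) i : (w <= S)%MS ->
  (colsub f w *m straighten) 0 i != 0 -> (i < \rank (colsub f S))%N.
Proof.
case/submxP => D ->; rewrite -mulmx_colsub -{1}(mulmx_ebase (colsub f S)).
rewrite /straighten !mulmxA mulmxK ?row_ebase_unit // mxE.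
apply: contraNltn => le_i; rewrite big1 // => j _; rewrite [pid_mx _ _ _]mxE.
by case: (nat_of_ord j =P i) => [->|_]; rewrite ?mulr0 // ltnNge le_i mulr0.
Qed.

Lemma rank_colsub : (\rank (colsub f S) <= \rank S)%N.
Proof. by rewrite -[S in colsub f S]mulmx1 -mulmx_colsub mxrankM_maxl. Qed.

End Columns.

Lemma mxsub_alt l (f g : 'I_l -> 'I_n) (P Q : 'M[K]_l) (x y : 'rV_n) i j :
  (P^T *m mxsub f g (alt_mx x y) *m Q) i j =
    (colsub f x *m P) 0 i * (colsub g y *m Q) 0 j -
    (colsub f y *m P) 0 i * (colsub g x *m Q) 0 j.
Proof.
have -> : mxsub f g (alt_mx x y) =
    (colsub f x)^T *m colsub g y - (colsub f y)^T *m colsub g x.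
  by apply/matrixP => a b; rewrite !mxE !big_ord1 !mxE.
rewrite mulmxBr mulmxBl !mulmxA -!trmx_mul -!mulmxA.
by rewrite !mxE !big_ord1 !mxE.
Qed.

Lemma sum_ltn_le (R : numDomainType) l s : \sum_(i < l) (i < s)%N%:R <= s%:R :> R.
Proof.
rewrite -natr_sum ler_nat; elim: l => [|l IHl]; first by rewrite big_ord0.
have [lt_ls|le_sl] := ltnP l s; last by rewrite big_ord_recr /= ltnNge le_sl addn0.
apply: (@leq_trans (\sum_(i < l.+1) 1)%N); first by apply: leq_sum => i _; case: (_ < _)%N.
by rewrite sum1_card card_ord.
Qed.

(** After straightening [S] on both sides, a nonzero entry of the matrix of
    the line [k] has at least [line_rank S k] of its two indices among the
    first [\rank S]: one of them if the line meets [S], as one of its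
    generators can be taken in [S], and both if it lies in [S].  So minus
    [line_rank S k] is a weight for which [weight_ge_blowup_det] applies. *)
Lemma blowup_degree_bound (R : realFieldType) l d (f g : 'I_l -> 'I_n)
    (S : 'M[K]_n) (z : 'X_{1..blowup_nvars m d}) :
    z \in msupp (\det (blowup_mx d (fun k => mxsub f g (alt_mx (u k) (v k))))) ->
  \sum_k (line_rank S k)%:R * block_degree R z k <= d%:R * (2 * (\rank S)%:R).
Proof.
set A := fun k => _; set P := straighten f S; set Q := straighten g S => zA.
have {zA} : z \in msupp (\det (blowup_mx d (fun k => P^T *m A k *m Q))).
  by rewrite msupp_blowup_conj ?unitmx_tr ?straighten_unit.
set sf := \rank (colsub f S); set sg := \rank (colsub g S).
have entry k i j : (P^T *m A k *m Q) i j != 0 ->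
    - (i < sf)%N%:R + - (j < sg)%N%:R <= - (line_rank S k)%:R :> R.
  move=> Aij0; rewrite -opprD lerN2 -natrD ler_nat.
  have [->//|q0] := posnP (line_rank S k).
  have [w [w0 wS wL]] := capmx_neq0 q0.
  have [w' [c [c0 eqA w'L Lww']]] := alt_mx_adapt wL w0.
  move: Aij0; rewrite /A eqA.
  rewrite (_ : mxsub f g _ = c *: mxsub f g (alt_mx w w')); last first.
    by apply/matrixP => a b; rewrite !mxE.
  rewrite -scalemxAr -scalemxAl mxE mulf_eq0 negb_or c0 /= mxsub_alt => ne0.
  have sfP (x : 'rV[K]_n) : (x <= S)%MS -> (colsub f x *m P) 0 i != 0 -> (i < sf)%N.
    exact: straightenP.
  have sgP (x : 'rV[K]_n) : (x <= S)%MS -> (colsub g x *m Q) 0 j != 0 -> (j < sg)%N.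
    exact: straightenP.
  have [q2|q1] := leqP 2 (line_rank S k).
    have /line_rank2_sub/(submx_trans w'L) w'S : line_rank S k = 2.
      by apply/eqP; rewrite eqn_leq line_rank_le2.
    suff [-> ->] : (i < sf)%N /\ (j < sg)%N by rewrite line_rank_le2.
    have [xy0|] := eqVneq ((colsub f w *m P) 0 i * (colsub g w' *m Q) 0 j) 0.
      move: ne0; rewrite xy0 sub0r oppr_eq0 mulf_eq0 negb_or => /andP[].
      by move=> /(sfP _ w'S) -> /(sgP _ wS) ->.
    by rewrite mulf_eq0 negb_or => /andP[] /(sfP _ wS) -> /(sgP _ w'S) ->.
  apply: leq_trans (_ : 1 <= _)%N; first by rewrite -ltnS.
  have [x0|/(sfP _ wS) -> //] := eqVneq ((colsub f w *m P) 0 i) 0.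
  move: ne0; rewrite x0 mul0r sub0r oppr_eq0 mulf_eq0 negb_or => /andP[_].
  by move=> /(sgP _ wS) ->; rewrite addn1.
move/(weight_ge_blowup_det (w := fun k => - (line_rank S k)%:R)
  (row := fun i => - (i < sf)%N%:R) (col := fun j => - (j < sg)%N%:R) entry).
rewrite block_weightE !sumrN -opprD mulrN.
rewrite (eq_bigr (fun k => - ((line_rank S k)%:R * block_degree R z k))); last first.
  by move=> k _; apply: mulNr.
rewrite sumrN lerN2 => /le_trans; apply.
rewrite ler_wpM2l // mulrDl mul1r.
by apply: lerD; apply: le_trans (sum_ltn_le _ _ _) _; rewrite ler_nat rank_colsub.
Qed.

End NewtonBound.

(** * Polytopes are hulls of their extreme points *)

Section Polytope.

Variables (R : realFieldType) (m : nat).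
Implicit Types (a : 'I_m -> R) (x y : 'rV[R]_m).

Definition dot a x : R := \sum_k a k * x 0 k.

Lemma dotD a x y : dot a (x + y) = dot a x + dot a y.
Proof. by rewrite -big_split; apply: eq_bigr => k _; rewrite mxE mulrDr. Qed.

Lemma dotZ a t x : dot a (t *: x) = t * dot a x.
Proof. by rewrite mulr_sumr; apply: eq_bigr => k _; rewrite mxE mulrCA. Qed.

Lemma dotN a x : dot a (- x) = - dot a x.
Proof. by rewrite -scaleN1r dotZ mulN1r. Qed.

Variables (C : finType) (a : C -> 'I_m -> R) (b : C -> R).

Definition polytope x : Prop := forall c, dot (a c) x <= b c.

Definition slack x : {set C} := [set c | dot (a c) x != b c].

Hypothesis bounded : forall y, y != 0 -> exists c, 0 < dot (a c) y.

(** Moving along a direction orthogonal to the tight constraints until the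
    first other constraint becomes tight. *)
Lemma polytope_shoot x y : polytope x -> y != 0 ->
    (forall c, dot (a c) x = b c -> dot (a c) y = 0) ->
  exists s, [/\ 0 < s, polytope (x + s *: y) & (#|slack (x + s *: y)| < #|slack x|)%N].
Proof.
move=> Px y0 xy; have [c0 c0y] := bounded y0.
case: (@arg_minP _ _ _ c0 (fun c => 0 < dot (a c) y)
  (fun c => (b c - dot (a c) x) / dot (a c) y) c0y) => c cy cmin.
set s := _ / _ in cmin; exists s.
have cE : dot (a c) (x + s *: y) = b c.
  by rewrite dotD dotZ /s divfK ?gt_eqF // addrC subrK.
have slack_c : c \in slack x.
  by rewrite inE; apply: contraTneq cy => /xy ->; rewrite ltxx.
have s0 : 0 < s.
  by move: slack_c; rewrite inE => xc; rewrite divr_gt0 // subr_gt0 lt_neqAle xc Px.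
split=> //.
  move=> c'; rewrite dotD dotZ; have [c'y|c'y] := ltP 0 (dot (a c') y).
    by rewrite -lerBrDl -ler_pdivlMr // cmin.
  by apply: le_trans (Px c'); rewrite gerDl mulr_ge0_le0 // ltW.
apply: proper_card; apply/properP; split; last by exists c => //; rewrite inE cE eqxx.
apply/fintype.subsetP => c'; rewrite !inE; apply: contraNneq => xc'.
by rewrite dotD dotZ xc' (xy _ xc') mulr0 addr0.
Qed.

(** A point that is not extreme lies between two points with fewer slack
    constraints. *)
Lemma polytope_extreme_ind (Q : 'rV[R]_m -> Prop) :
    (forall x y t, 0 <= t <= 1 -> Q x -> Q y -> Q (t *: x + (1 - t) *: y)) ->
    (forall x, polytope x ->
      (forall y, (forall c, dot (a c) x = b c -> dot (a c) y = 0) -> y = 0) ->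
      Q x) ->
  forall x, polytope x -> Q x.
Proof.
move=> Qconv Qext x; move: {2}_.+1 (ltnSn #|slack x|) => N.
elim: N x => // N IHN x ltN Px.
have [[y [xy y0]]|noy] :=
    pselect (exists y, (forall c, dot (a c) x = b c -> dot (a c) y = 0) /\ y != 0).
  have [s [s0 Ps Ns]] := polytope_shoot Px y0 xy.
  have [||t [t0 Pt Nt]] := polytope_shoot (y := - y) Px; first by rewrite oppr_eq0.
    by move=> c /xy; rewrite dotN => ->; rewrite oppr0.
  have st0 : s + t != 0 by rewrite gt_eqF ?addr_gt0.
  have -> : x = (t / (s + t)) *: (x + s *: y) + (1 - t / (s + t)) *: (x + t *: - y).
    by apply/rowP => k; rewrite !mxE; field.
  apply: Qconv.
  - rewrite divr_ge0 ?addr_ge0 ?(ltW s0) ?(ltW t0) //=.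
    by rewrite ler_pdivrMr ?addr_gt0 // mul1r lerDr ltW.
  - by apply: IHN => //; apply: leq_trans Ns _.
  - by apply: IHN => //; apply: leq_trans Nt _.
apply: Qext => // y xy; apply/eqP; apply: contra_notT noy => y0.
by exists y.
Qed.

End Polytope.

(** * The polytope of a family of lines *)

Section LinePolytope.

Variables (R : realFieldType) (K : fieldType) (m n : nat) (u v : 'I_m -> 'rV[K]_n).
Hypothesis rank_line : forall k, \rank (u k + v k)%MS = 2.
Implicit Types (S T : 'M[K]_n) (p y : 'rV[R]_m).

Local Notation q := (line_rank u v).

Definition qdot S : 'rV[R]_m -> R := dot (fun k => (q S k)%:R).

Definition line_polytope p : Prop :=
  (forall k, 0 <= p 0 k) /\ (forall S, qdot S p <= 2 * (\rank S)%:R).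

Definition tight p S : Prop := qdot S p = 2 * (\rank S)%:R.

Definition extreme p : Prop :=
  forall y, (forall k, p 0 k = 0 -> y 0 k = 0) ->
    (forall S, tight p S -> qdot S y = 0) -> y = 0.

(** A subspace enters the constraints only through finitely many bounded
    integers, so finitely many subspaces give all the constraints. *)
Lemma line_rank_reps : exists (C : finType) (rep : C -> 'M[K]_n), forall S,
  exists c, \rank (rep c) = \rank S /\ q (rep c) =1 q S.
Proof.
pose C := ('I_n.+1 * {ffun 'I_m -> 'I_3})%type.
pose data S : C := (inord (\rank S), [ffun k => inord (q S k)]).
have /choice[rep repP] (c : C) : exists T, (exists S, data S = c) -> data T = c.
  have [[S Sc]|no] := pselect (exists S, data S = c); first by exists S.
  by exists 0 => /no.
exists C, rep => S; exists (data S).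
have [r_eq q_eq] := repP (data S) (ex_intro _ S erefl).
split.
  by have := congr1 val r_eq; rewrite /= !inordK // ltnS rank_leq_row.
move=> k; have := congr1 (fun h : {ffun 'I_m -> 'I_3} => val (h k)) q_eq.
by rewrite /= !ffunE !inordK // ltnS line_rank_le2.
Qed.

Lemma line_rank1 k : q 1%:M k = 2.
Proof. by rewrite /line_rank cap1mx rank_line. Qed.

Lemma line_polytope_ind (Q : 'rV[R]_m -> Prop) :
    (forall x y t, 0 <= t <= 1 -> Q x -> Q y -> Q (t *: x + (1 - t) *: y)) ->
    (forall p, line_polytope p -> extreme p -> Q p) ->
  forall p, line_polytope p -> Q p.
Proof.
move=> Qconv Qext p Pp; have [C [rep repP]] := line_rank_reps.
pose a (c : 'I_m + C) (k : 'I_m) : R :=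
  match c with inl i => - (i == k)%:R | inr c => (q (rep c) k)%:R end.
pose b (c : 'I_m + C) : R :=
  match c with inl _ => 0 | inr c => 2 * (\rank (rep c))%:R end.
have al i x : dot (a (inl i)) x = - x 0 i.
  rewrite /dot (bigD1 i) //= eqxx mulN1r big1 ?addr0 // => k ki.
  by rewrite eq_sym (negbTE ki) oppr0 mul0r.
have repE S : exists2 c, qdot S =1 dot (a (inr c)) & b (inr c) = 2 * (\rank S)%:R.
  have [c [rE qE]] := repP S; exists c; last by rewrite /b rE.
  by move=> x; apply: eq_bigr => k _; rewrite /a qE.
have polyE x : line_polytope x <-> polytope a b x.
  split=> [[x0 xS] [i|c]|Px]; first by rewrite al oppr_le0.
    exact: xS.
  split=> [k|S]; first by have := Px (inl k); rewrite al oppr_le0.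
  by have [c -> <-] := repE S; apply: Px.
have bdd y : y != 0 -> exists c, 0 < dot (a c) y.
  move=> y0; have [[k yk]|nok] := pselect (exists k, y 0 k < 0).
    by exists (inl k); rewrite al oppr_gt0.
  have yge k : 0 <= y 0 k by rewrite leNgt; apply/negP => yk; case: nok; exists k.
  have [c cE _] := repE 1%:M; exists (inr c); rewrite -cE.
  have /rV0Pn[k yk] := y0.
  rewrite /qdot /dot (bigD1 k) //= ltr_wpDr //.
    by apply: sumr_ge0 => i _; rewrite mulr_ge0.
  by rewrite mulr_gt0 ?line_rank1 // lt_neqAle eq_sym yk yge.
apply: (polytope_extreme_ind bdd Qconv _ ((polyE p).1 Pp)) => x Px xext.
apply: Qext => [|y yz yt]; first exact/polyE.
apply: xext => -[i|c].
  by rewrite !al => /eqP; rewrite oppr_eq0 => /eqP/yz ->; rewrite oppr0.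
exact: yt.
Qed.

Lemma line_polytope_convex x y t : 0 <= t <= 1 ->
  line_polytope x -> line_polytope y -> line_polytope (t *: x + (1 - t) *: y).
Proof.
case/andP=> t0 t1 [x0 xS] [y0 yS]; have t1' : 0 <= 1 - t by rewrite subr_ge0.
split=> [k|S]; first by rewrite !mxE addr_ge0 ?mulr_ge0.
rewrite /qdot dotD !dotZ.
have -> : 2 * (\rank S)%:R =
  t * (2 * (\rank S)%:R) + (1 - t) * (2 * (\rank S)%:R) :> R by ring.
by rewrite lerD // ler_wpM2l //; [exact: xS|exact: yS].
Qed.

End LinePolytope.

(** * Tight subspaces *)

Section Tight.

Variables (R : realFieldType) (K : fieldType) (m n : nat) (u v : 'I_m -> 'rV[K]_n).
Variable p : 'rV[R]_m.
Hypothesis Pp : line_polytope u v p.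
Implicit Types (S T U : 'M[K]_n) (y : 'rV[R]_m).

Local Notation q := (line_rank u v).
Local Notation qdot := (qdot u v).
Local Notation tight := (tight u v p).

Lemma line_rankS S T k : (S <= T)%MS -> (q S k <= q T k)%N.
Proof. by move=> ST; rewrite mxrankS // capmxS. Qed.

Lemma line_rank_le_rank S T k :
  (S <= T)%MS -> (q T k + \rank S <= \rank T + q S k)%N.
Proof.
move=> ST; rewrite -mxrank_sum_cap leq_add // mxrankS //.
  by rewrite addsmx_sub capmxSl.
by rewrite capmxC capmxS // capmxSr.
Qed.

Lemma line_rank_supermodular S T k :
  (q S k + q T k <= q (S + T)%MS k + q (S :&: T)%MS k)%N.
Proof.
rewrite -mxrank_sum_cap leq_add // mxrankS //.
  by rewrite addsmx_sub !capmxS ?addsmxSl ?addsmxSr.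
rewrite !sub_capmx.
rewrite (submx_trans (capmxSl _ _) (capmxSl _ _)).
rewrite (submx_trans (capmxSr _ _) (capmxSl _ _)).
by rewrite (submx_trans (capmxSl _ _) (capmxSr _ _)).
Qed.

Lemma tight0 : tight 0.
Proof.
rewrite /tight mxrank0 mulr0 /qdot /dot big1 // => k _.
by rewrite /line_rank cap0mx mxrank0 mul0r.
Qed.

(** The defect [2 * \rank S - qdot S p] is submodular and nonnegative; hence
    its zeros form a lattice on which it is modular, term by term. *)
Lemma tight_lattice S T : tight S -> tight T ->
  [/\ tight (S + T)%MS, tight (S :&: T)%MS &
   forall k, p 0 k != 0 -> (q S k + q T k = q (S + T)%MS k + q (S :&: T)%MS k)%N].
Proof.
move=> tS tT; have [p0 bound] := Pp.
pose D k : R := (q (S + T)%MS k)%:R + (q (S :&: T)%MS k)%:R - ((q S k)%:R + (q T k)%:R).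
have D0 k : 0 <= D k by rewrite subr_ge0 -!natrD ler_nat line_rank_supermodular.
have sumD : qdot (S + T)%MS p + qdot (S :&: T)%MS p - (qdot S p + qdot T p) =
    \sum_k D k * p 0 k.
  rewrite /qdot /dot -!big_split -sumrB /=; apply: eq_bigr => k _.
  by rewrite /D; ring.
have rk : (\rank (S + T)%MS)%:R + (\rank (S :&: T)%MS)%:R =
    (\rank S)%:R + (\rank T)%:R :> R by rewrite -!natrD mxrank_sum_cap.
have D1 k : 0 <= D k * p 0 k by rewrite mulr_ge0.
(* The defects of the two sides of the modularity relation are nonnegative
   and differ by the nonnegative sum of the [D k * p 0 k], which thus vanishes. *)
have sum0 : 0 <= \sum_k D k * p 0 k by apply: sumr_ge0.
have b1 := bound (S + T)%MS; have b2 := bound (S :&: T)%MS.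
rewrite -/(qdot _ _) in b1 b2.
have sum_eq0 : \sum_k D k * p 0 k = 0.
  by apply/eqP; rewrite eq_le sum0 andbT -sumD tS tT; lra.
rewrite sum_eq0 tS tT in sumD.
split; [rewrite /tight; lra|rewrite /tight; lra|move=> k pk].
have /eqP := @psumr_eq0P _ _ predT _ (fun k _ => D1 k) sum_eq0 k isT.
rewrite mulf_eq0 (negbTE pk) orbF subr_eq0 -!natrD eqr_nat => /eqP //.
Qed.

Lemma tight_modular S T y : (forall k, p 0 k = 0 -> y 0 k = 0) ->
    tight S -> tight T ->
  qdot S y + qdot T y = qdot (S + T)%MS y + qdot (S :&: T)%MS y.
Proof.
move=> yz tS tT; have [_ _ qE] := tight_lattice tS tT.
rewrite /qdot /dot -!big_split /=; apply: eq_bigr => k _; rewrite -!mulrDl -!natrD.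
by have [/yz ->|/qE ->//] := eqVneq (p 0 k) 0; rewrite !mulr0.
Qed.

Definition saturated r (C : nat -> 'M[K]_n) : Prop :=
  [/\ C 0%N = 0, forall i, (i < r)%N -> tight (C i.+1),
      forall i, (i < r)%N -> (C i < C i.+1)%MS &
      forall i U, (i < r)%N -> tight U -> (C i <= U)%MS -> (U <= C i.+1)%MS ->
        (U <= C i)%MS \/ (C i.+1 <= U)%MS].

Lemma max_rank (P : 'M[K]_n -> Prop) S0 : P S0 ->
  exists2 S, P S & forall T, P T -> (\rank T <= \rank S)%N.
Proof.
move=> PS0; pose Q i := `[< exists2 S, P S & \rank S = i >].
have exQ : exists i, Q i by exists (\rank S0); apply/asboolP; exists S0.
have ubQ i : Q i -> (i <= n)%N.
  by move=> /asboolP[S _ <-]; apply: rank_leq_row.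
case: (ex_maxnP exQ ubQ) => i /asboolP[S PS <-] imax; exists S => // T PT.
by apply: imax; apply/asboolP; exists T.
Qed.

Lemma saturated_chain T : tight T -> exists r C, saturated r C /\ C r = T.
Proof.
move: {2}_.+1 (ltnSn (\rank T)) => N; elim: N T => // N IHN T ltN tT.
have [T0|rT] := posnP (\rank T).
  exists 0%N, (fun=> 0); split=> //.
  by apply/esym/eqP; rewrite -mxrank_eq0 T0.
have [|U [tU ltUT] Umax] := @max_rank (fun U => tight U /\ (U < T)%MS) 0.
  by split; [exact: tight0|rewrite ltmxErank sub0mx mxrank0].
have [|r [C [[C0 Ct Clt Csat] CrU]]] := IHN U _ tU.
  by rewrite -ltnS (leq_trans _ ltN) // ltnS; move: ltUT; rewrite ltmxErank => /andP[].
exists r.+1, (fun i => if (i <= r)%N then C i else T); rewrite ltnn; split=> //.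
have ltS_case i : (i < r.+1)%N -> i = r \/ (i < r)%N.
  by rewrite ltnS leq_eqVlt => /predU1P.
split=> [//|i|i|i W] /ltS_case[->|lt_ir].
- by rewrite ltnn.
- by rewrite lt_ir; apply: Ct.
- by rewrite leqnn ltnn CrU.
- by rewrite (ltnW lt_ir) lt_ir; apply: Clt.
- rewrite leqnn ltnn CrU => tW UW WT.
  have [TW|nTW] := boolP (T <= W)%MS; [by right|left].
  rewrite -(geq_leqif (mxrank_leqif_sup UW)); apply: Umax; split=> //.
  by rewrite ltmxE WT.
- by rewrite (ltnW lt_ir) lt_ir; apply: Csat.
Qed.

Lemma full_saturated_chain :
  exists r C, saturated r C /\ forall U, tight U -> (U <= C r)%MS.
Proof.
have [T tT Tmax] := max_rank tight0.
have [r [C [Csat CrT]]] := saturated_chain tT.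
exists r, C; split=> // U tU; rewrite CrT.
have [tTU _ _] := tight_lattice tT tU.
apply: submx_trans (addsmxSr T U) _.
by rewrite -(geq_leqif (mxrank_leqif_sup (addsmxSl T U))) Tmax.
Qed.

End Tight.

(** * Extreme points *)

Section Extreme.

Variables (R : realFieldType) (K : fieldType) (m n : nat) (u v : 'I_m -> 'rV[K]_n).
Hypothesis rank_line : forall k, \rank (u k + v k)%MS = 2.
Variable p : 'rV[R]_m.
Hypotheses (Pp : line_polytope u v p) (ext : extreme u v p).
Variables (r : nat) (S : nat -> 'M[K]_n).
Hypotheses (satS : saturated u v p r S).
Hypothesis maxS : forall U, tight u v p U -> (U <= S r)%MS.

Local Notation q := (line_rank u v).
Local Notation qdot := (qdot u v).
Local Notation tight := (tight u v p).

(** The matrix [step] is the incidence matrix of the graph whose vertices are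
    the levels of the chain and whose edges are the lines; an edge may have
    both ends at one level, and at this stage it may have fewer than two. *)
Definition step i k : nat := q (S i.+1) k - q (S i) k.
Definition height i : nat := \rank (S i.+1) - \rank (S i).

Lemma chain_sub i j : (i <= j)%N -> (j <= r)%N -> (S i <= S j)%MS.
Proof.
have [_ _ Slt _] := satS.
elim: j => [|j IHj]; first by rewrite leqn0 => /eqP ->.
rewrite leq_eqVlt ltnS => /predU1P[-> //|/IHj{}IHj] lt_jr.
by apply: submx_trans (IHj (ltnW lt_jr)) (ltmxW (Slt j lt_jr)).
Qed.

Lemma chain_tight i : (i <= r)%N -> tight (S i).
Proof.
have [S0 St _ _] := satS.
by case: i => [_|i /St //]; rewrite S0; apply: tight0.
Qed.

Lemma stepE i k : (i < r)%N -> (q (S i.+1) k = q (S i) k + step i k)%N.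
Proof. by move=> lt_ir; rewrite subnKC // line_rankS // chain_sub. Qed.

Lemma heightE i : (i < r)%N -> (\rank (S i.+1) = \rank (S i) + height i)%N.
Proof. by move=> lt_ir; rewrite subnKC // mxrankS // chain_sub. Qed.

Lemma height_gt0 i : (i < r)%N -> (0 < height i)%N.
Proof.
have [_ _ Slt _] := satS.
by move=> /Slt; rewrite ltmxErank subn_gt0 => /andP[].
Qed.

Lemma sum_step k j : (j <= r)%N -> (\sum_(i < j) step i k = q (S j) k)%N.
Proof.
elim: j => [_|j IHj lt_jr]; last by rewrite big_ord_recr /= IHj ?stepE // ltnW.
by have [-> _ _ _] := satS; rewrite big_ord0 /line_rank cap0mx mxrank0.
Qed.

Lemma qdot_step i (y : 'rV[R]_m) : (i < r)%N ->
  \sum_k (step i k)%:R * y 0 k = qdot (S i.+1) y - qdot (S i) y.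
Proof.
move=> lt_ir; rewrite /qdot /dot -sumrB; apply: eq_bigr => k _.
by rewrite stepE // natrD; ring.
Qed.

Lemma qdot_step_p i : (i < r)%N ->
  \sum_k (step i k)%:R * p 0 k = 2 * (height i)%:R.
Proof.
move=> lt_ir; rewrite qdot_step // !chain_tight ?(ltnW lt_ir) //.
by rewrite heightE // natrD; ring.
Qed.

(** A direction annihilated by every step of the chain is annihilated by
    every tight [U]: modularity expresses [U :&: S i.+1] through
    [U :&: S i] and [U :&: S i.+1 + S i], and the latter is [S i] or [S i.+1]. *)
Lemma step_inj (y : 'rV[R]_m) : (forall k, p 0 k = 0 -> y 0 k = 0) ->
  (forall i, (i < r)%N -> \sum_k (step i k)%:R * y 0 k = 0) -> y = 0.
Proof.
move=> yz yN; apply: ext => // U tU.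
have [S0 _ _ Ssat] := satS.
have qdot0 : qdot 0 y = 0.
  by apply: big1 => k _; rewrite /line_rank cap0mx mxrank0 mul0r.
have qdotE X Y : (X == Y)%MS -> qdot X y = qdot Y y.
  move/eqmxP => XY; apply: eq_bigr => k _.
  by rewrite /line_rank (cap_eqmx XY (eqmx_refl _)).
have qdotS i : (i <= r)%N -> qdot (S i) y = 0.
  elim: i => [_|i IHi lt_ir]; first by rewrite S0.
  by have := qdot_step y lt_ir; rewrite yN // IHi ?(ltnW lt_ir) // subr0 => <-.
suff US i : (i <= r)%N -> qdot (U :&: S i)%MS y = 0.
  rewrite (qdotE _ (U :&: S r)%MS) ?US //.
  by rewrite capmxSl sub_capmx submx_refl maxS.
elim: i => [_|i IHi lt_ir]; first by rewrite S0 (qdotE _ 0) // capmx0 !submx_refl.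
have tS1 := chain_tight lt_ir; have tS := chain_tight (ltnW lt_ir).
have [_ tUS1 _] := tight_lattice Pp tU tS1.
have [tW _ _] := tight_lattice Pp tUS1 tS.
have := tight_modular Pp yz tUS1 tS.
rewrite (qdotE (U :&: S i.+1 :&: S i)%MS (U :&: S i)%MS); last first.
  apply/andP; split; rewrite !sub_capmx; apply/andP; split; rewrite ?capmxSr //.
    exact: submx_trans (capmxSl _ _) (capmxSl _ _).
  by rewrite capmxSl (submx_trans (capmxSr _ _) (chain_sub _ _)).
rewrite IHi ?(ltnW lt_ir) // qdotS ?(ltnW lt_ir) // !addr0 => ->.
have WS1 : (U :&: S i.+1 + S i <= S i.+1)%MS by rewrite addsmx_sub capmxSr chain_sub.
have [WS|S1W] := Ssat i _ lt_ir tW (addsmxSr _ _) WS1.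
  by rewrite (qdotE _ (S i)) ?qdotS ?(ltnW lt_ir) // WS addsmxSr.
by rewrite (qdotE _ (S i.+1)) ?qdotS // WS1 S1W.
Qed.

Lemma p_ge0 k : 0 <= p 0 k. Proof. by have [p0 _] := Pp. Qed.

Lemma line_rank_self k : q (u k + v k)%MS k = 2.
Proof. by rewrite /line_rank (capmx_idPl (submx_refl _)) rank_line. Qed.

Lemma le_qdot U k : (q U k)%:R * p 0 k <= qdot U p.
Proof.
rewrite /qdot /dot (bigD1 k) //= lerDl; apply: sumr_ge0 => j _.
by rewrite mulr_ge0 ?p_ge0.
Qed.

Lemma p_le2 k : p 0 k <= 2.
Proof.
have [_ /(_ (u k + v k)%MS) b] := Pp; have := le_trans (le_qdot _ k) b.
by rewrite line_rank_self rank_line ler_pM2l.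
Qed.

Lemma p2_sub k : p 0 k = 2 -> (u k + v k <= S r)%MS.
Proof.
move=> pk; apply: maxS; apply/eqP; rewrite eq_le; apply/andP; split.
  by have [_] := Pp; apply.
by have := le_qdot (u k + v k)%MS k; rewrite line_rank_self rank_line pk.
Qed.

(** If [p 0 k = 2], adding one vector of the line [k] to a tight subspace
    gives a tight subspace, so a chain that cannot be refined climbs one
    dimension at a time along such lines. *)
Lemma height_p2 i k : p 0 k = 2 -> (i < r)%N -> (0 < step i k)%N -> height i = 1.
Proof.
move=> pk lt_ir; rewrite subn_gt0 => lt_q.
have : ~~ (S i.+1 :&: (u k + v k) <= S i :&: (u k + v k))%MS.
  by apply: contraL lt_q => le_S; rewrite -leqNgt /line_rank mxrankS.
case/row_subPn => j; set w := row j _ => w_nS.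
have wS1 : (w <= S i.+1)%MS by apply: submx_trans (row_sub _ _) (capmxSl _ _).
have wL : (w <= u k + v k)%MS by apply: submx_trans (row_sub _ _) (capmxSr _ _).
have {w_nS} w_nS : ~~ (w <= S i)%MS by move: w_nS; rewrite sub_capmx wL andbT.
set U := (S i + w)%MS.
have SU : (S i <= U)%MS by apply: addsmxSl.
have US1 : (U <= S i.+1)%MS by rewrite addsmx_sub wS1 chain_sub.
have rU : (\rank U <= (\rank (S i)).+1)%N.
  rewrite -addn1 (leq_trans (mxrank_adds_leqif _ _)) // leq_add2l.
  exact: rank_leq_row.
have qU : (q (S i) k < q U k)%N.
  suff : (S i :&: (u k + v k) < U :&: (u k + v k))%MS by rewrite ltmxErank => /andP[].
  rewrite ltmxE capmxS //=; apply: contra w_nS => le_U.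
  apply: submx_trans (submx_trans le_U (capmxSl _ _)).
  by rewrite sub_capmx addsmxSr.
have tS := chain_tight (ltnW lt_ir).
have qdotU : qdot (S i) p + 2 <= qdot U p.
  rewrite addrC -lerBrDr /qdot /dot -sumrB (bigD1 k) //= -mulrBl pk.
  have : 1 <= (q U k)%:R - (q (S i) k)%:R :> R.
    by rewrite -natrB ?(ltnW qU) // ler1n subn_gt0.
  move=> q1; rewrite ler_wpDr //; last by rewrite -[leLHS]mul1r ler_wpM2r.
  apply: sumr_ge0 => j' _; rewrite -mulrBl mulr_ge0 ?p_ge0 //.
  by rewrite subr_ge0 ler_nat line_rankS.
have tU : tight U.
  apply/eqP; rewrite eq_le; apply/andP; split; first by have [_] := Pp; apply.
  apply: le_trans qdotU; rewrite tS.
  have : (\rank U)%:R <= (\rank (S i))%:R + 1 :> R by rewrite natr1 ler_nat.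
  by lra.
have [_ _ _ Ssat] := satS.
have [US|S1U] := Ssat i U lt_ir tU SU US1.
  by case/negP: w_nS; apply: submx_trans US; apply: addsmxSr.
have := height_gt0 lt_ir; have := leq_trans (mxrankS S1U) rU.
by rewrite heightE // -addn1 leq_add2l; case: (height i) => [|[]].
Qed.

(** The edges whose value is not an even integer. *)
Let F : {set 'I_m} := [set k | (p 0 k != 0) && (p 0 k != 2)].
Let V : {set 'I_r} := [set i : 'I_r | [exists k in F, step i k != 0]].
Let M i : nat := \sum_(k | p 0 k == 2) step i k.

Lemma sum_step_F i : (i < r)%N ->
  \sum_(k in F) (step i k)%:R * p 0 k = 2 * ((height i)%:R - (M i)%:R).
Proof.
move=> lt_ir; rewrite mulrBr -qdot_step_p // /M natr_sum mulr_sumr.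
rewrite [X in _ = X - _](bigID (fun k => p 0 k == 2)) /= addrAC.
rewrite -sumrB [X in _ = X + _]big1 ?add0r => [|k /eqP ->]; last by rewrite mulrC subrr.
rewrite [RHS](bigID (fun k => p 0 k == 0)) /=.
rewrite [X in _ = X + _]big1 ?add0r => [|k /andP[_ /eqP ->]].
  by apply: eq_bigl => k; rewrite inE andbC.
by rewrite mulr0.
Qed.

Lemma F_bounds k : k \in F -> 0 < p 0 k < 2.
Proof.
by rewrite inE => /andP[p0 p2]; rewrite !lt_neqAle p_ge0 p_le2 eq_sym p0 p2.
Qed.

(** A single line of [F] meeting a level once would carry an even integer,
    because all the other values at that level are even. *)
Lemma row_F i : i \in V -> (2 <= \sum_(k in F) step i k)%N.
Proof.
rewrite inE => /existsP[k /andP[kF sk]]; rewrite leqNgt; apply/negP => lt2.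
have := sum_step_F (ltn_ord i).
rewrite (bigD1 k) //= in lt2; rewrite (bigD1 k) //=.
have s1 : step i k = 1 by move: sk lt2; lia.
rewrite big1 ?addr0 => [|j /andP[jF jk]]; last first.
  suff -> : step i j = 0 by rewrite mul0r.
  by move: lt2; rewrite s1 (bigD1 j) ?jF //=; lia.
rewrite s1 mul1r => pE; have := F_bounds kF; rewrite pE.
have [hM|Mh] := leqP (height i) (M i).
  by rewrite pmulr_rgt0 // subr_gt0 ltr_nat ltnNge hM.
by case/andP => _; rewrite -natrB ?(ltnW Mh) // -natrM ltr_nat; lia.
Qed.

(** The incidence matrix of [F] and [V] has independent rows, by [step_inj]. *)
Lemma card_F : (#|F| <= #|V|)%N.
Proof.
pose A : 'M[R]_(#|F|, #|V|) :=
  \matrix_(a < #|F|, b < #|V|) (step (enum_val b : 'I_r) (enum_val a : 'I_m))%:R.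
suff /eqnP <- : row_free A by apply: rank_leq_col.
apply: inj_row_free => x xA.
pose y : 'rV[R]_m := \row_k \sum_(a | enum_val a == k) x 0 a.
have yE a : y 0 (enum_val a) = x 0 a.
  by rewrite mxE (eq_bigl (pred1 a)) ?big_pred1_eq // => b; rewrite (inj_eq enum_val_inj).
have y0 k : k \notin F -> y 0 k = 0.
  by move=> kF; rewrite mxE big1 // => a /eqP ka; rewrite -ka enum_valP in kF.
suff yz : y = 0 by apply/rowP => a; rewrite -yE yz !mxE.
apply: step_inj => [k pk|i lt_ir]; first by rewrite y0 // inE pk eqxx.
rewrite (bigID (mem F)) /= [X in _ + X]big1 ?addr0 => [|k kF]; last by rewrite y0 ?mulr0.
have [iV|iV] := boolP (Ordinal lt_ir \in V); last first.
  apply: big1 => k kF; suff -> : step i k = 0 by rewrite mul0r.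
  apply/eqP; apply: contraNT iV => sk; rewrite inE; apply/existsP; exists k.
  by rewrite kF.
rewrite big_enum_val /=.
have /rowP/(_ (enum_rank_in iV (Ordinal lt_ir))) := xA.
rewrite !mxE => xA0; rewrite -[RHS]xA0; apply: eq_bigr => a _.
by rewrite yE mulrC !mxE enum_rankK_in.
Qed.

(** Every vertex of [V] meets at least two ends of edges of [F], every edge
    has at most two ends, and there are at most as many edges as vertices;
    so equality holds everywhere. *)
Lemma F_regular :
  (forall i, i \in V -> (\sum_(k in F) step i k = 2)%N) /\
  (forall k, k \in F -> q (S r) k = 2).
Proof.
have colF k : k \in F -> (\sum_(i in V) step i k = q (S r) k)%N.
  move=> kF; rewrite -(sum_step _ (leqnn r)) [RHS](bigID (mem V)) /=.
  rewrite [X in (_ + X)%N]big1 ?addn0 // => i.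
  rewrite inE negb_exists => /forallP/(_ k).
  by rewrite negb_and kF negbK => /eqP.
have rows : (\sum_(i in V) 2 <= \sum_(i in V) \sum_(k in F) step i k)%N.
  by apply: leq_sum => i; apply: row_F.
have cols : (\sum_(i in V) \sum_(k in F) step i k <= \sum_(k in F) 2)%N.
  by rewrite exchange_big /=; apply: leq_sum => k kF; rewrite colF // line_rank_le2.
have cardFV : (\sum_(k in F) 2 <= \sum_(i in V) 2)%N.
  by rewrite !sum_nat_const leq_mul2r card_F.
have eq1 : (\sum_(i in V) 2 = \sum_(i in V) \sum_(k in F) step i k)%N by lia.
have eq2 : (\sum_(i in V) \sum_(k in F) step i k = \sum_(k in F) 2)%N by lia.
split=> [i iV|k kF].
  have [_] := leqif_sum (fun i (iV : i \in V) => leqif_eq (row_F iV)).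
  by rewrite eq1 eqxx => /esym/forall_inP/(_ _ iV)/eqP.
rewrite exchange_big /= in eq2.
have [_] := leqif_sum (fun k (_ : k \in F) => leqif_eq (line_rank_le2 u v (S r) k)).
rewrite -eq2 (eq_bigr _ colF) eqxx => /esym/forall_inP/(_ _ kF)/eqP //.
Qed.

(** At a vertex of [V] the values of the edges of [F] add up to an even integer
    strictly between 0 and 4, that is to 2.  The values 1 have the same sums, and the sums
    determine the values. *)
Lemma p_F k : k \in F -> p 0 k = 1.
Proof.
move: k; have [rowF _] := F_regular.
pose y : 'rV[R]_m := \row_k (if k \in F then p 0 k - 1 else 0).
suff yz : y = 0.
  move=> k kF; have /rowP/(_ k) := yz; rewrite !mxE kF => /eqP.
  by rewrite subr_eq0 => /eqP.
apply: step_inj => [k pk|i lt_ir]; first by rewrite mxE inE pk eqxx.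
have -> : \sum_k (step i k)%:R * y 0 k = \sum_(k in F) (step i k)%:R * (p 0 k - 1).
  rewrite [RHS]big_mkcond; apply: eq_bigr => k _; rewrite mxE.
  by case: ifP => // _; rewrite mulr0.
have [iV|iV] := boolP (Ordinal lt_ir \in V); last first.
  apply: big1 => k kF; suff -> : step i k = 0 by rewrite mul0r.
  apply/eqP; apply: contraNT iV => sk; rewrite inE; apply/existsP; exists k.
  by rewrite kF.
have rowi : (\sum_(k in F) step i k = 2)%N := rowF _ iV.
rewrite (eq_bigr _ (fun k _ => mulrBr _ _ _)) sumrB (eq_bigr _ (fun k _ => mulr1 _)).
rewrite -natr_sum rowi sum_step_F //.
suff -> : (height i)%:R - (M i)%:R = 1 :> R by rewrite mulr1 subrr.
have := sum_step_F lt_ir.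
have pos : 0 < \sum_(k in F) (step i k)%:R * p 0 k.
  have := iV; rewrite inE => /existsP[k /andP[kF sk]].
  rewrite (bigD1 k) //= ltr_wpDr //.
    by apply: sumr_ge0 => j _; rewrite mulr_ge0 ?p_ge0.
  by rewrite mulr_gt0 ?ltr0n ?lt0n //; case/andP: (F_bounds kF).
(* Two ends of edges of value less than 2. *)
have small : \sum_(k in F) (step i k)%:R * p 0 k < 4.
  have -> : 4 = \sum_(k in F) (step i k)%:R * 2 :> R.
    by rewrite -mulr_suml -natr_sum rowi; ring.
  have := iV; rewrite inE => /existsP[k /andP[kF sk]].
  rewrite (bigD1 k) //= [ltRHS](bigD1 k) //= ltr_leD //.
    by rewrite ltr_pM2l ?ltr0n ?lt0n //; case/andP: (F_bounds kF).
  by apply: ler_sum => j _; rewrite ler_wpM2l ?p_le2.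
move=> sE; rewrite sE in pos small.
have [hM|Mh] := leqP (height i) (M i).
  by move: pos; rewrite pmulr_rgt0 // subr_gt0 ltr_nat ltnNge hM.
move: small; rewrite -natrB ?(ltnW Mh) // -natrM ltr_nat => small.
suff -> : (height i - M i = 1)%N by [].
by lia.
Qed.

Lemma p_nat k : exists e : nat, p 0 k = e%:R /\ (e <= 2)%N.
Proof.
have [->|p0] := eqVneq (p 0 k) 0; first by exists 0%N.
have [->|p2] := eqVneq (p 0 k) 2; first by exists 2%N.
by exists 1%N; split=> //; apply: p_F; rewrite inE p0.
Qed.

(** An edge of value 2 forces dimension 1 by [height_p2]; without such an edge
    the total value at the level is that of two ends of edges of value 1. *)
Lemma height1 i : (i < r)%N -> height i = 1.
Proof.
move=> lt_ir; have [M0|] := posnP (M i); last first.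
  rewrite lt0n sum_nat_eq0 negb_forall => /existsP[k].
  by rewrite negb_imply => /andP[/eqP pk sk]; apply: height_p2 pk lt_ir _; rewrite lt0n.
have sE : (\sum_(k in F) step i k = 2 * height i)%N.
  apply/eqP; rewrite -(eqr_nat R) natr_sum natrM.
  have := sum_step_F lt_ir; rewrite M0 subr0 => <-; apply/eqP.
  by apply: eq_bigr => k /p_F ->; rewrite mulr1.
have h0 := height_gt0 lt_ir.
have [iV|iV] := boolP (Ordinal lt_ir \in V).
  have [/(_ _ iV) rowi _] := F_regular.
  by move: sE; rewrite rowi; lia.
suff s0 : (\sum_(k in F) step i k = 0)%N by lia.
apply: big1 => k kF; apply/eqP; apply: contraNT iV => sk; rewrite inE; apply/existsP.
by exists k; rewrite kF.
Qed.

Lemma rank_chain i : (i <= r)%N -> \rank (S i) = i.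
Proof.
elim: i => [_|i IHi lt_ir]; last by rewrite heightE // IHi ?height1 ?addn1 // ltnW.
by have [-> _ _ _] := satS; rewrite mxrank0.
Qed.

Lemma support_sub k : p 0 k != 0 -> q (S r) k = 2.
Proof.
move=> p0; have [p2|p2] := eqVneq (p 0 k) 2; last first.
  by have [_] := F_regular; apply; rewrite inE p0.
by rewrite /line_rank (capmx_idPr (p2_sub p2)) rank_line.
Qed.

End Extreme.

(** The combinatorial content of extremality, freed from the chain of tight
    subspaces: what is left is a flag, a graph with values 0, 1, 2, and the
    fact that the equations at the vertices determine the values. *)
Lemma extreme_structure (R : realFieldType) (K : fieldType) (m n : nat)
    (u v : 'I_m -> 'rV[K]_n) (p : 'rV[R]_m) :
    (forall k, \rank (u k + v k)%MS = 2) ->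
    line_polytope u v p -> extreme u v p ->
  exists r (S : nat -> 'M[K]_n), [/\
    [/\ forall i, (i <= r)%N -> \rank (S i) = i,
        forall i j, (i <= j <= r)%N -> (S i <= S j)%MS &
        forall k, p 0 k != 0 -> line_rank u v (S r) k = 2],
    forall k, exists e : nat, p 0 k = e%:R /\ (e <= 2)%N,
    forall i, (i < r)%N -> \sum_k (step u v S i k)%:R * p 0 k = 2 &
    forall y : 'rV[R]_m, (forall k, p 0 k = 0 -> y 0 k = 0) ->
      (forall i, (i < r)%N -> \sum_k (step u v S i k)%:R * y 0 k = 0) -> y = 0].
Proof.
move=> rank_line Pp ext; have [r [S [satS maxS]]] := full_saturated_chain Pp.
exists r, S; split; first split.
- exact: (rank_chain rank_line Pp ext satS maxS).
- by move=> i j /andP[]; apply: (chain_sub satS).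
- exact: (support_sub rank_line Pp ext satS maxS).
- exact: (p_nat rank_line Pp ext satS maxS).
- move=> i lt_ir; rewrite (qdot_step_p satS lt_ir).
  by rewrite (height1 rank_line Pp ext satS maxS) // mulr1.
- exact: (step_inj Pp ext satS maxS).
Qed.

(** * The skew matrix of a graph *)

Section GraphMatrix.

Variables (K : fieldType) (m r : nat) (lo hi : 'I_m -> 'I_r) (c : 'I_m -> K).
Variable e : 'I_m -> nat.
Hypothesis e_le2 : forall k, (e k <= 2)%N.
Hypothesis c_neq0 : forall k, c k != 0.
Hypothesis lo_hi : forall k, e k != 0%N -> lo k != hi k.
Hypothesis degree2 : forall i,
  (\sum_k e k * ((lo k == i) + (hi k == i)) = 2)%N.

(** The Tutte matrix of the graph with edges [{lo k, hi k}], given by its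
    coefficients; the edges with [e k = 0] are absent. *)
Definition graph_mx k : 'M[K]_r :=
  if e k == 0%N then 0
  else c k *: (delta_mx (lo k) (hi k) - delta_mx (hi k) (lo k)).

(** Specialisation of the [k]-th generic matrix: the identity on isolated
    edges, a matrix of rank one on the edges of the cycles, with pairwise
    independent row spaces. *)
Let beta (k : 'I_m) : 'rV[{poly K}]_2 := \row_j (if j == 0 then 1 else 'X^k).
Let special (k : 'I_m) : 'M[{poly K}]_2 :=
  if e k == 2 then 1%:M else (beta k)^T *m beta k.
Let spec : {mpoly K[blowup_nvars m 2]} -> {poly K} :=
  mmap polyC (fun x => let: (k, i, j) := enum_val x in special k i j).

Let M : 'M[{poly K}]_(r * 2) :=
  \sum_k tensmx (map_mx polyC (graph_mx k)) (special k).

Lemma spec_blowup : map_mx spec (blowup_mx 2 graph_mx) = M.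
Proof.
apply/matrixP => p q; rewrite mxE blowup_mxE summxE /spec rmorph_sum.
apply: eq_bigr => k _; rewrite rmorphM /= mmapC mmapX mmap1U.
by rewrite /blowup_var enum_rankK !mxE.
Qed.

Let incident k i := (e k != 0%N) && ((lo k == i) || (hi k == i)).

Lemma incident_degree k i :
  (e k * ((lo k == i) + (hi k == i)) = if incident k i then e k else 0)%N.
Proof.
rewrite /incident; have [->|/lo_hi lohi] := eqVneq (e k) 0%N; first by rewrite mul0n.
case: (lo k =P i) => [<-|_]; first by rewrite eq_sym (negbTE lohi) muln1.
by case: eqP; rewrite ?muln1 ?muln0.
Qed.

Lemma incident_cases k i : incident k i ->
  (e k = 2 /\ forall k', k' != k -> ~~ incident k' i) \/
  exists k', [/\ k' != k, e k = 1%N, e k' = 1%N, incident k' i &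
    forall k'', k'' != k -> k'' != k' -> ~~ incident k'' i].
Proof.
move=> ki; have := degree2 i; under eq_bigr do rewrite incident_degree.
have e_gt0 k' : incident k' i -> (0 < e k')%N by rewrite lt0n => /andP[].
have no_incident (P : pred 'I_m) :
    (\sum_(k' | P k') (if incident k' i then e k' else 0) = 0)%N ->
    forall k', P k' -> ~~ incident k' i.
  move/eqP; rewrite sum_nat_eq0 => /forallP P0 k' Pk'; apply/negP => k'i.
  by have := P0 k'; rewrite Pk' k'i => /eqP e0; have := e_gt0 k' k'i; rewrite e0.
rewrite (bigD1 k) //= ki; have := e_le2 k; have := e_gt0 k ki.
case ek: (e k) => [|[|[|]]] // _ _ sumE; last first.
  left; split=> //; apply: (no_incident (fun k' => k' != k)).
  exact: (@addnI 2 _ 0%N sumE).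
have {sumE} sum1 : (\sum_(k' | k' != k) (if incident k' i then e k' else 0) = 1)%N.
  exact: (@addnI 1 _ 1%N sumE).
right; have : (\sum_(k' | k' != k) (if incident k' i then e k' else 0) != 0)%N.
  by rewrite sum1.
rewrite sum_nat_eq0 negb_forall => /existsP[k']; rewrite negb_imply => /andP[k'k].
case: ifP => // k'i _; exists k'.
rewrite (bigD1 k') //= k'i in sum1; have := e_gt0 k' k'i.
case ek': (e k') sum1 => [|[|?]] // sum1 _.
split=> // k'' k''k k''k'.
apply: (no_incident (fun j => (j != k) && (j != k'))); last by rewrite k''k.
exact: (@addnI 1 _ 0%N sum1).
Qed.

Lemma incident_ex i : exists k, incident k i.
Proof.
have [//|no] := pselect (exists k, incident k i); have := degree2 i.
rewrite big1 // => k _; rewrite incident_degree.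
by case: ifP => // ki; case: no; exists k.
Qed.

Lemma polyXn_sub_neq0 (k k' : 'I_m) : k' != k -> 'X^k - 'X^k' != 0 :> {poly K}.
Proof.
rewrite subr_eq0; apply: contraNneq => XX; apply/eqP/ord_inj.
by have := congr1 (size : {poly K} -> nat) XX; rewrite !size_polyXn => -[].
Qed.

Lemma beta_free k k' (a b : {poly K}) : k' != k ->
  a *: beta k + b *: beta k' = 0 -> a = 0 /\ b = 0.
Proof.
move=> k'k /rowP ab; have := ab 0; have := ab 1; rewrite !mxE /= !mulr1.
move=> ab1 /eqP; rewrite addr_eq0 => /eqP aE; move: ab1; rewrite aE => ab1.
suff b0 : b = 0 by rewrite b0 oppr0.
apply/eqP; have : b * ('X^k - 'X^k') == 0 
  by apply/eqP; move/(congr1 -%R): ab1; rewrite oppr0 => <-; ring.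
by rewrite mulf_eq0 (negbTE (polyXn_sub_neq0 k'k)) orbF.
Qed.

Lemma beta_dual k k' (x : 'rV[{poly K}]_2) : k' != k ->
  x *m (beta k)^T = 0 -> x *m (beta k')^T = 0 -> x = 0.
Proof.
move=> k'k /rowP/(_ 0) xk /rowP/(_ 0) xk'; move: xk xk'.
rewrite !mxE !big_ord_recl !big_ord0 !mxE /= !mulr1 !addr0 => /eqP.
rewrite addr_eq0 => /eqP x0; rewrite x0 => xk.
have x1 : x 0 1 = 0.
  apply/eqP; have : x 0 1 * ('X^k - 'X^k') == 0.
    apply/eqP; move/(congr1 -%R): xk; rewrite oppr0 => <-.
    by rewrite (_ : lift ord0 ord0 = 1); [ring|apply/val_inj].
  by rewrite mulf_eq0 (negbTE (polyXn_sub_neq0 k'k)) orbF.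
apply/rowP => j; rewrite mxE.
have [->|->] : j = 0 \/ j = 1 by case: j => [[|[|]]] // ?; [left|right]; apply/val_inj.
  by rewrite x0 (_ : lift ord0 ord0 = 1) ?x1 ?mul0r ?oppr0 //; apply/val_inj.
by rewrite x1.
Qed.

Section Kernel.

Variable y : 'rV[{poly K}]_(r * 2).
Hypothesis yM : y *m M = 0.

Let blk i : 'rV[{poly K}]_2 := \row_a y 0 (mxtens_index (i, a)).

(** The [i]-th block of [y *m M] is the sum of these contributions of the
    edges [k]; the sign is that of the orientation of the edge. *)
Let term k i : 'rV[{poly K}]_2 :=
  if ~~ incident k i then 0
  else if hi k == i then (c k)%:P *: (blk (lo k) *m special k)
  else - (c k)%:P *: (blk (hi k) *m special k).

Lemma sum_term i : \sum_k term k i = 0.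
Proof.
apply/rowP => b; rewrite summxE mxE.
have /rowP/(_ (mxtens_index (i, b))) := yM; rewrite !mxE => yM0; rewrite -[RHS]yM0.
rewrite (reindex (@mxtens_index r 2)); last first.
  by exists (@mxtens_unindex r 2) => x _; rewrite (mxtens_indexK, mxtens_unindexK).
transitivity (\sum_j \sum_a y 0 (mxtens_index (j, a)) *
    M (mxtens_index (j, a)) (mxtens_index (i, b))); last first.
  by rewrite pair_bigA; apply: eq_bigr => -[j a] _.
transitivity (\sum_k \sum_j \sum_a
    y 0 (mxtens_index (j, a)) * ((graph_mx k j i)%:P * special k a b)); last first.
  rewrite exchange_big; apply: eq_bigr => j _; rewrite exchange_big.
  apply: eq_bigr => a _; rewrite -mulr_sumr summxE; congr (_ * _).
  by apply: eq_bigr => k _; rewrite tensmxE mxE.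
apply: eq_bigr => k _.
transitivity (\sum_j (graph_mx k j i)%:P * (blk j *m special k) 0 b); last first.
  apply: eq_bigr => j _; rewrite mxE mulr_sumr; apply: eq_bigr => a _.
  by rewrite mxE mulrCA.
rewrite /term /incident /graph_mx; have [e0|e0] /= := eqVneq (e k) 0%N.
  by rewrite mxE big1 // => j _; rewrite mxE polyC0 mul0r.
have lohi := lo_hi e0.
have entry j : (c k *: (delta_mx (lo k) (hi k) - delta_mx (hi k) (lo k))) j i =
    c k * (((j == lo k) && (i == hi k))%:R - ((j == hi k) && (i == lo k))%:R).
  by rewrite !mxE.
under eq_bigr do rewrite entry.
have [hik|hik] := eqVneq (hi k) i.
  rewrite orbT -hik (bigD1 (lo k)) //= !eqxx (negbTE lohi) /= subr0 mulr1.
  rewrite [LHS]mxE big1 ?addr0 // => j /negbTE ->.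
  by rewrite [hi k == lo k]eq_sym (negbTE lohi) andbF subrr mulr0 polyC0 mul0r.
have [lok|lok] /= := eqVneq (lo k) i.
  rewrite (bigD1 (hi k)) //= eqxx andbF sub0r mulrN mulr1.
  rewrite [LHS]mxE polyCN big1 ?addr0 // => j /negbTE ->.
  by rewrite andbF subrr mulr0 polyC0 mul0r.
by rewrite mxE big1 // => j _; rewrite !andbF subrr mulr0 polyC0 mul0r.
Qed.

Let other k i := if hi k == i then lo k else hi k.

Lemma term_other k i : incident k i -> exists2 s : {poly K}, s != 0 &
  term k i = s *: (blk (other k i) *m special k).
Proof.
move=> ki; have cP : (c k)%:P != 0 by rewrite polyC_eq0.
rewrite /term /other ki /=; case: eqP => _; first by exists (c k)%:P.
by exists (- (c k)%:P); rewrite ?oppr_eq0.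
Qed.

Lemma term_not k i : ~~ incident k i -> term k i = 0.
Proof. by rewrite /term => ->. Qed.

Lemma special1 k (x : 'rV_2) :
  e k = 1%N -> x *m special k = (x *m (beta k)^T) 0 0 *: beta k.
Proof.
by rewrite /special => ->; rewrite mulmxA {1}[x *m _]mx11_scalar mul_scalar_mx.
Qed.

(** A level meets either one edge, with an invertible matrix, or two edges
    whose contributions are multiples of independent vectors; as the
    contributions cancel, each of them is zero. *)
Lemma other_blk k i : incident k i -> blk (other k i) *m special k = 0.
Proof.
move=> ki; have [s s0 sE] := term_other ki; have := sum_term i.
have [[_ no]|[k' [k'k ek ek' k'i no]]] := incident_cases ki.
  rewrite (bigD1 k) //= big1 ?addr0 => [|k' /no/term_not //]; rewrite sE => /eqP.
  by rewrite scalemx_eq0 (negbTE s0) => /eqP.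
have [s' _ s'E] := term_other k'i.
rewrite (bigD1 k) //= (bigD1 k') //= big1 ?addr0 => [|j /andP[jk jk']]; last first.
  exact/term_not/no.
rewrite sE s'E !special1 // !scalerA => /(beta_free k'k)[/eqP + _].
by rewrite mulf_eq0 (negbTE s0) /= => /eqP ->; rewrite scale0r.
Qed.

Lemma ends_blk k i : incident k i -> blk i *m special k = 0.
Proof.
rewrite /incident => /andP[e0 ki].
have ne : (hi k == lo k) = false by rewrite eq_sym (negbTE (lo_hi e0)).
have [hik|hik] := eqVneq (hi k) i.
  have := @other_blk k (lo k); rewrite /other ne hik; apply.
  by rewrite /incident e0 eqxx.
have lok : lo k = i by move: ki; rewrite (negbTE hik) orbF => /eqP.
have := @other_blk k (hi k); rewrite /other eqxx lok; apply.
by rewrite /incident e0 eqxx orbT.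
Qed.

Lemma ends_beta k i : incident k i -> e k = 1%N -> blk i *m (beta k)^T = 0.
Proof.
move=> ki ek; have := ends_blk ki; rewrite special1 // => /eqP.
rewrite scalemx_eq0 => /orP[/eqP b0|/eqP/rowP/(_ 0)]; last first.
  by rewrite !mxE => /eqP; rewrite oner_eq0.
by apply/matrixP => a b; rewrite !ord1 b0 mxE.
Qed.

(** A component orthogonal to the vectors of the two edges at a level, or
    killed by the identity, is zero. *)
Lemma blk_eq0 i : blk i = 0.
Proof.
have [k ki] := incident_ex i.
have [[ek _]|[k' [k'k ek ek' k'i _]]] := incident_cases ki.
  by have := ends_blk ki; rewrite /special ek mulmx1.
exact: beta_dual k'k (ends_beta ki ek) (ends_beta k'i ek').
Qed.

Lemma kernel_eq0 : y = 0.
Proof.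
apply/rowP => x; case: (mxtens_indexP x) => i a.
by have /rowP/(_ a) := blk_eq0 i; rewrite !mxE.
Qed.

End Kernel.

Lemma graph_det_neq0 : \det (blowup_mx 2 graph_mx) != 0.
Proof.
have detM : \det M != 0.
  by apply/det0P => -[y y0 /kernel_eq0 yz]; rewrite yz eqxx in y0.
by apply: contra_neq detM => det0; rewrite -spec_blowup /spec det_map_mx det0 rmorph0.
Qed.

End GraphMatrix.

(** * Flags and coordinates *)

(** The columns selected by [fullrankfun] come in an arbitrary order; indexing
    them by the set of their positions permutes them, which keeps the rank. *)
Lemma row_free_colset (K : fieldType) r n (E : 'M[K]_(r, n)) : row_free E ->
  exists I : {set 'I_n},
    #|I| = r /\ \rank (colsub (fun i : 'I_#|I| => enum_val i) E) = r.
Proof.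
move=> Efree; have Efull : row_full E^T by rewrite /row_full mxrank_tr.
pose f := fullrankfun Efull.
have fI : injective f := @fullrankfun_inj _ _ _ _ Efull.
pose I := [set f i | i : 'I_r]; exists I.
split; first by rewrite card_imset // card_ord.
set EI := colsub _ _; apply/eqP; rewrite eqn_leq rank_leq_row /=.
have rf : \rank (rowsub f E^T) = r by apply/eqP; apply: fullrowsub_free.
rewrite -{1}rf -(mxrank_tr EI); apply: mxrankS; apply/row_subP => i.
have fiI : f i \in I by apply: imset_f.
rewrite (_ : row i _ = row (enum_rank_in fiI (f i)) EI^T) ?row_sub //.
by apply/rowP => j; rewrite !mxE enum_rankK_in.
Qed.

Section FlagCoordinates.

Variables (K : fieldType) (n r : nat) (S : nat -> 'M[K]_n).
Hypothesis rankS : forall i, (i <= r)%N -> \rank (S i) = i.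
Hypothesis subS : forall i j, (i <= j <= r)%N -> (S i <= S j)%MS.

(** Choosing the [i]-th basis vector in [S i.+1] but not in [S i], the
    coordinates of a vector show the first member of the flag containing it. *)
Lemma flag_basis : exists E : 'M[K]_(r, n), row_free E /\
  forall i (w : 'rV_n), (i < r)%N -> (w <= S i.+1)%MS ->
    exists x : 'rV_r, [/\ w = x *m E, forall t, x 0 t != 0 -> (t <= i)%N &
      ~~ (w <= S i)%MS -> forall t : 'I_r, t = i :> nat -> x 0 t != 0].
Proof.
have ex_row (i : 'I_r) : exists w : 'rV[K]_n, (w <= S i.+1)%MS /\ ~~ (w <= S i)%MS.
  have : ~~ (S i.+1 <= S i)%MS.
    by apply/negP => /mxrankS; rewrite !rankS ?ltnn // ltnW.
  by case/row_subPn => j wS; exists (row j (S i.+1)); rewrite row_sub.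
have [E' E'P] := choice ex_row.
pose E : 'M[K]_(r, n) := \matrix_i E' i.
have row_basis i : row i E = E' i by rewrite rowK.
have coord i (w : 'rV_n) : (i <= r)%N -> (w <= S i)%MS ->
    exists x : 'rV_r, w = x *m E /\ forall t, x 0 t != 0 -> (t < i)%N.
  elim: i w => [|i IHi] w.
    move=> _ wS; exists 0; split=> [|t]; last by rewrite mxE eqxx.
    rewrite mul0mx; apply/eqP; rewrite -submx0; apply: submx_trans wS _.
    by rewrite submx0 -mxrank_eq0 rankS.
  move=> lt_ir; set i' := Ordinal lt_ir; have [ES nES] := E'P i'.
  have SE : (S i.+1 <= S i + E' i')%MS.
    have le : (S i + E' i' <= S i.+1)%MS by rewrite addsmx_sub ES subS // leqnSn.
    rewrite -(geq_leqif (mxrank_leqif_sup le)) rankS //.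
    (* The rank of [S i.+1] is only one more than that of [S i]. *)
    suff : (S i < S i + E' i')%MS by rewrite ltmxErank (rankS (ltnW lt_ir)) => /andP[].
    rewrite ltmxE addsmxSl; apply: contra nES; apply: submx_trans.
    exact: addsmxSr.
  move=> /submx_trans/(_ SE)/sub_addsmxP[[D1 D2] /= ->].
  have [|x [xE xlt]] := IHi (D1 *m S i) (ltnW lt_ir); first exact: submxMl.
  exists (x + D2 0 0 *: delta_mx 0 i'); split.
    by rewrite mulmxDl -xE -scalemxAl -rowE row_basis {1}(mx11_scalar D2) mul_scalar_mx.
  move=> t; rewrite !mxE /= ltnS leq_eqVlt.
  case: (t =P i') => [->|_]; first by rewrite eqxx.
  by rewrite mulr0 addr0 => /xlt ->; rewrite orbT.
exists E; split.
  rewrite /row_free eqn_leq rank_leq_row /= -{1}(rankS (leqnn r)); apply: mxrankS.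
  apply/row_subP => j; have [|x [-> _]] := coord r (row j (S r)) (leqnn r).
    exact: row_sub.
  exact: submxMl.
move=> i w lt_ir wS; have [x [wE xle]] := coord i.+1 w lt_ir wS.
exists x; split=> // wnS t ti; apply: contra wnS => /eqP xt.
rewrite wE mulmx_sum_row; apply: summx_sub => s _; rewrite row_basis.
have [->|xs] := eqVneq (x 0 s) 0; first by rewrite scale0r sub0mx.
have [ES _] := E'P s; apply: scalemx_sub; apply: submx_trans ES _; apply: subS.
have := xle s xs; rewrite ltnS leq_eqVlt => /predU1P[si|->]; last by rewrite ltnW.
by case/eqP: xs; rewrite -xt; congr (x 0 _); apply/val_inj; rewrite /= si ti.
Qed.

End FlagCoordinates.

(** Applied to the dimensions of the intersections of a line with the members
    of a flag, this gives the two ends of the corresponding edge. *)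
Lemma two_climbs r (f : nat -> nat) : f 0%N = 0%N -> f r = 2 ->
    (forall i, (i < r)%N -> (f i <= f i.+1 <= (f i).+1)%N) ->
  exists lo hi, [/\ (lo < hi < r)%N, f lo = 0%N, f hi = 1%N &
    forall i, (i < r)%N -> (f i.+1 - f i = (lo == i) + (hi == i))%N].
Proof.
move=> f0 fr fS.
have mono i j : (i <= j <= r)%N -> (f i <= f j)%N.
  elim: j => [|j IHj]; first by rewrite leqn0 andbT => /eqP ->.
  case/andP; rewrite leq_eqVlt => /predU1P[-> //|ij] jr.
  by have := IHj; have := fS j jr; lia.
have ex1 c : (c < 2)%N -> exists i, (i < r)%N && (f i <= c < f i.+1)%N.
  move=> c2; have exP : exists i, (i <= r)%N && (f i <= c)%N by exists 0%N; rewrite f0.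
  have ub i : (i <= r)%N && (f i <= c)%N -> (i <= r)%N by case/andP.
  case: (ex_maxnP exP ub) => i /andP[ir fi] imax; exists i.
  have lt_ir : (i < r)%N.
    by rewrite ltn_neqAle ir andbT; apply/eqP => E; move: fi; rewrite E fr; lia.
  rewrite lt_ir fi /= ltnNge; apply/negP => fi1.
  by have := imax i.+1; rewrite lt_ir fi1 ltnn => /(_ isT).
have [//|lo /andP[lor loP]] := ex1 0%N.
have [//|hi /andP[hir hiP]] := ex1 1%N.
have loS := fS lo lor; have hiS := fS hi hir.
have lohi : (lo < hi)%N.
  rewrite ltnNge; apply/negP => hilo.
  by have := mono hi.+1 lo.+1; rewrite ltnS hilo lor => /(_ isT); lia.
have mid := mono lo.+1 hi; rewrite lohi (ltnW hir) in mid.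
exists lo, hi; split; [by rewrite lohi|lia|by have := mid isT; lia|].
move=> i ir; have iS := fS i ir.
have [lt_i|gt_i|ilo] := ltngtP i lo; last by
  rewrite ilo in iS *; rewrite (gtn_eqF lohi); lia.
  have := mono i.+1 lo; rewrite lt_i (ltnW lor) => /(_ isT).
  by rewrite (gtn_eqF (ltn_trans lt_i lohi)); lia.
have [lt_i|gt_hi|ihi] := ltngtP i hi; last by rewrite ihi in iS *; have := mid isT; lia.
  have := mono lo.+1 i; rewrite gt_i (ltnW ir) => /(_ isT).
  by have := mono i.+1 hi; rewrite lt_i (ltnW hir) => /(_ isT); lia.
have := mono hi.+1 i; rewrite gt_hi (ltnW ir) => /(_ isT).
by have := mono i.+1 r; rewrite ir leqnn => /(_ isT); lia.
Qed.

(** * Extreme points are exponents of the second blow-up *)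

Lemma det_size0 (F : comNzRingType) N (M : 'M[F]_N) : N = 0%N -> \det M = 1.
Proof. by move=> N0; move: M; rewrite N0 => M; apply: det_mx00. Qed.

Section GraphWeight.

Variables (R : realFieldType) (K : fieldType) (m r : nat).
Variables (lo hi : 'I_m -> 'I_r) (c : 'I_m -> K) (e : 'I_m -> nat).

Lemma graph_mx_neq0 k a b : graph_mx lo hi c e k a b != 0 ->
  e k != 0%N /\ ((a = lo k /\ b = hi k) \/ (a = hi k /\ b = lo k)).
Proof.
rewrite /graph_mx; case: ifP => e0; first by rewrite mxE eqxx.
rewrite !mxE => G; split=> //; move: G.
case: andP => [[/eqP-> /eqP->] _|_]; first by left.
case: andP => [[/eqP-> /eqP->] _|_]; first by right.
by rewrite subrr mulr0 eqxx.
Qed.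

(** The determinant of the graph matrix is homogeneous for every weight that
    is, on each edge, the sum of weights of its two ends. *)
Lemma graph_weight (w : 'I_m -> R) (lev : 'I_r -> R) z :
    (forall k, e k != 0%N -> w k = lev (lo k) + lev (hi k)) ->
    z \in msupp (\det (blowup_mx 2 (graph_mx lo hi c e))) ->
  \sum_k w k * block_degree R z k = 4 * \sum_i lev i.
Proof.
move=> wE zG.
have lower k a b : graph_mx lo hi c e k a b != 0 -> lev a + lev b <= w k.
  by case/graph_mx_neq0 => /wE -> [] [-> ->]; rewrite 1?addrC.
have upper k a b : graph_mx lo hi c e k a b != 0 -> - lev a + - lev b <= - w k.
  by case/graph_mx_neq0 => /wE -> [] [-> ->]; rewrite opprD 1?addrC.
have := weight_ge_blowup_det lower zG; have := weight_ge_blowup_det upper zG.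
rewrite !block_weightE [X in _ <= X -> _](eq_bigr (fun k => - (w k * block_degree _ z k))).
  2: by move=> k _; rewrite mulNr.
rewrite !sumrN -opprD mulrN lerN2 => le1 le2.
have -> : 4 * \sum_i lev i = 2%:R * (\sum_i lev i + \sum_i lev i) by ring.
by apply/le_anti; rewrite le1 le2.
Qed.

End GraphWeight.

Lemma msupp_diff (K : fieldType) nv (f g : {mpoly K[nv]}) z :
  z \notin msupp (f - g) -> z \in msupp g -> z \in msupp f.
Proof.
rewrite -mcoeff_eq0 mcoeffB subr_eq0 => /eqP fg.
by rewrite !mcoeff_msupp fg.
Qed.

Section Leading.

Variables (K : fieldType) (m r : nat).
Variables (lo hi : 'I_m -> 'I_r) (c : 'I_m -> K) (e : 'I_m -> nat).
Variable A : 'I_m -> 'M[K]_r.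
Hypothesis A_low : forall k (i j : 'I_r),
  e k != 0%N -> A k i j != 0 -> (i + j <= lo k + hi k)%N.
Hypothesis A_lead : forall k (i j : 'I_r), e k != 0%N -> (lo k + hi k <= i + j)%N ->
  A k i j = graph_mx lo hi c e k i j.

(** Multiplying the variables of the edge [k] by [t ^ (lo k + hi k)] and the
    rows and columns of level [i] by [t ^ - i] produces only nonnegative powers
    of [t], and leaves the graph matrix at [t = 0].  So the determinant of the
    graph matrix is a homogeneous component of the whole determinant; the
    lines outside the graph are removed by giving them a larger weight. *)
Lemma graph_component z :
  z \in msupp (\det (blowup_mx 2 (graph_mx lo hi c e))) ->
  z \in msupp (\det (blowup_mx 2 A)).
Proof.
(* The weight [r + r] exceeds every [i + j + 1]. *)
pose w (k : 'I_m) : rat := (if e k == 0%N then r + r else lo k + hi k)%N%:R.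
pose lev (i : 'I_r) : rat := i%:R.
have lev_lt k (i j : 'I_r) : e k == 0%N -> lev i + lev j + 1 <= w k.
  move=> e0; rewrite /w /lev e0 -natrD natr1 ler_nat.
  by have := ltn_ord i; have := ltn_ord j; lia.
have low k (i j : 'I_r) : A k i j != 0 -> lev i + lev j <= w k.
  move=> Aij; have [e0|e0] := eqVneq (e k) 0%N.
    by apply: le_trans (lev_lt k i j _); rewrite ?lerDl ?e0.
  by rewrite /w /lev (negbTE e0) -natrD ler_nat A_low.
have lead k (i j : 'I_r) : A k i j != graph_mx lo hi c e k i j ->
    lev i + lev j + 1 <= w k.
  move=> AG; have [e0|e0] := eqVneq (e k) 0%N; first by rewrite lev_lt ?e0.
  rewrite /w /lev (negbTE e0) -natrD natr1 ler_nat ltnNge.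
  by apply: contra AG => le_ij; rewrite A_lead.
move=> zG; have wz : \sum_k w k * block_degree _ z k = 4 * \sum_i lev i.
  by apply: graph_weight zG => k e0; rewrite /w (negbTE e0) natrD.
have := weight_ge_blowup_det_diff (d := 2) low lead.
move=> /(_ z) diff; apply: msupp_diff zG; apply/negP => /diff.
by rewrite block_weightE wz; lra.
Qed.

End Leading.

Lemma sum_le_eq (a b c d : nat) :
  (c + d <= a + b)%N -> (a <= c)%N -> (b <= d)%N -> a = c /\ b = d.
Proof. by lia. Qed.

Section ExtremeExponent.

Variables (R : realFieldType) (K : fieldType) (m n : nat) (u v : 'I_m -> 'rV[K]_n).
Hypothesis rank_line : forall k, \rank (u k + v k)%MS = 2.

Let submatrices (I : {set 'I_n}) (k : 'I_m) : 'M[K]_#|I| :=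
  mxsub (fun i : 'I_#|I| => enum_val i) (fun i : 'I_#|I| => enum_val i)
    (alt_mx (u k) (v k)).

(** The rows and columns [I] are chosen so that the top of the flag projects
    isomorphically onto [K^I]; in coordinates adapted to the flag, a line with
    ends [lo < hi] has generators with last nonzero coordinates [lo] and [hi],
    so that its entries satisfy [i + j <= lo + hi], and the graph matrix
    collects those with equality. *)
Lemma extreme_exponent (p : 'rV[R]_m) :
    line_polytope u v p -> extreme u v p ->
  exists (I : {set 'I_n}) (z : 'X_{1..blowup_nvars m 2}),
    z \in msupp (\det (blowup_mx 2 (submatrices I))) /\
    forall k, block_degree R z k = 2 * p 0 k.
Proof.
move=> Pp ext.
have [r [S [[rankS subS topS] p_nat sum_p inj_p]]] := extreme_structure rank_line Pp ext.
have [e eP] := choice p_nat.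
have pE k : p 0 k = (e k)%:R by have [] := eP k.
have e_le2 k : (e k <= 2)%N by have [] := eP k.
have e_neq0 k : (e k != 0%N) = (p 0 k != 0) by rewrite pE pnatr_eq0.
have [r0|r_gt0] := posnP r.
  have p0 : p = 0 by apply: inj_p => // i; rewrite r0.
  exists finset.set0, 0%MM; split.
    by rewrite det_size0 ?cards0 // msupp1 inE.
  move=> k; rewrite p0 mxE mulr0 /block_degree big1 // => i _.
  by rewrite big1 // => j _; rewrite mnm0E.
have [E [Efree Ecoord]] := flag_basis rankS subS.
have [I [cardI rankEI]] := row_free_colset Efree.
subst r.
set EI := colsub _ E in rankEI.
have EIu : EI \in unitmx by rewrite -row_free_unit /row_free rankEI.
set F := invmx EI.
have climbs k : exists lh : 'I_#|I| * 'I_#|I|, e k != 0%N ->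
    [/\ (lh.1 < lh.2)%N, line_rank u v (S lh.1) k = 0%N,
      line_rank u v (S lh.2) k = 1%N &
      forall i, (i < #|I|)%N ->
        step u v S i k = ((lh.1 == i :> nat) + (lh.2 == i :> nat))%N].
  have [e0|e0] := eqVneq (e k) 0%N; first by exists (Ordinal r_gt0, Ordinal r_gt0).
  have [||i lt_ir|lo [hi [/andP[lohi hir] flo fhi stepP]]] :=
      @two_climbs #|I| (fun i => line_rank u v (S i) k).
  - apply/eqP; rewrite -leqn0; apply: leq_trans (mxrankS (capmxSl _ _)) _.
    by rewrite rankS.
  - by apply: topS; rewrite -e_neq0.
  - have SS : (S i <= S i.+1)%MS by rewrite subS // leqnSn.
    rewrite line_rankS //= ; have := line_rank_le_rank u v k SS.
    by rewrite !rankS ?(ltnW lt_ir) //; lia.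
  by exists (Ordinal (ltn_trans lohi hir), Ordinal hir).
have [lh lhP] := choice climbs.
pose lo k := (lh k).1; pose hi k := (lh k).2.
have lo_hi k : e k != 0%N -> (lo k < hi k)%N by case/lhP.
have stepE k i : e k != 0%N -> (i < #|I|)%N ->
  step u v S i k = ((lo k == i :> nat) + (hi k == i :> nat))%N by case/lhP => _ _ _; apply.
pose A k := F^T *m submatrices I k *m F.
have coordF x : colsub (fun i : 'I_#|I| => enum_val i) (x *m E) *m F = x.
  by rewrite -mulmx_colsub mulmxK.
have lead k : exists c, c != 0 /\ (e k != 0%N -> forall i j : 'I_#|I|,
    (A k i j != 0 -> (i + j <= lo k + hi k)%N) /\
    ((lo k + hi k <= i + j)%N -> A k i j =
      c * (((i == lo k) && (j == hi k))%:R - ((i == hi k) && (j == lo k))%:R))).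
  have [e0|e0] := eqVneq (e k) 0%N; first by exists 1; rewrite oner_eq0.
  have [lt_lohi q_lo q_hi _] := lhP k e0.
  have q_lo1 : line_rank u v (S (lo k).+1) k = 1%N.
    have := stepE k (lo k) e0 (ltn_ord _); rewrite eqxx /step.
    by rewrite (gtn_eqF (lo_hi k e0)) /lo q_lo subn0.
  have q_hi1 : line_rank u v (S (hi k).+1) k = 2.
    have := stepE k (hi k) e0 (ltn_ord _); rewrite eqxx /step.
    by rewrite (ltn_eqF (lo_hi k e0)) /hi q_hi; lia.
  have [|w [w0 wS wL]] := @capmx_neq0 _ _ (S (lo k).+1) (u k + v k)%MS.
    by move: q_lo1; rewrite /line_rank => ->.
  have [w' [c [c0 altE w'L Lww']]] := alt_mx_adapt wL w0.
  have w_lo : ~~ (w <= S (lo k))%MS.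
    apply/negP => wlo; have : (w <= S (lo k) :&: (u k + v k))%MS by rewrite sub_capmx wlo.
    move/mxrankS; rewrite -/(line_rank u v (S (lo k)) k) /lo q_lo leqn0 mxrank_eq0.
    by rewrite (negbTE w0).
  have w'S : (w' <= S (hi k).+1)%MS by apply: submx_trans w'L (line_rank2_sub q_hi1).
  have w'_hi : ~~ (w' <= S (hi k))%MS.
    apply/negP => w'hi; have : (u k + v k <= S (hi k))%MS.
      apply: submx_trans Lww' _; rewrite addsmx_sub w'hi andbT.
      by apply: (submx_trans wS); apply: subS; rewrite lo_hi //= ltnW.
    by move/capmx_idPr => cap; move: q_hi; rewrite /line_rank -/(hi k) cap rank_line.
  have [x [wE xle xlo]] := Ecoord (lo k) w (ltn_ord _) wS.
  have [x' [w'E x'le x'hi]] := Ecoord (hi k) w' (ltn_ord _) w'S.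
  have xlo0 : x 0 (lo k) != 0 by apply: xlo.
  have x'hi0 : x' 0 (hi k) != 0 by apply: x'hi.
  have AE i j : A k i j = c * (x 0 i * x' 0 j - x' 0 i * x 0 j).
    rewrite /A /submatrices altE (_ : mxsub _ _ _ = c *: mxsub
      (fun i : 'I_#|I| => enum_val i) (fun i : 'I_#|I| => enum_val i) (alt_mx w w')).
      by rewrite -scalemxAr -scalemxAl mxE mxsub_alt wE w'E !coordF.
    by apply/matrixP => a b; rewrite !mxE.
  have prod_le (a b : 'I_#|I|) : x 0 a * x' 0 b != 0 -> (a <= lo k)%N /\ (b <= hi k)%N.
    by rewrite mulf_eq0 negb_or => /andP[/xle ? /x'le ?].
  have prod_lead (a b : 'I_#|I|) : (lo k + hi k <= a + b)%N ->
      x 0 a * x' 0 b = x 0 (lo k) * x' 0 (hi k) * ((a == lo k) && (b == hi k))%:R.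
    move=> le_ab; case: andP => [[/eqP-> /eqP->]|ne]; first by rewrite mulr1.
    rewrite mulr0; apply/eqP; apply/negPn/negP => /prod_le[le_a le_b].
    have [] := sum_le_eq le_ab le_a le_b.
    by move=> /val_inj ea /val_inj eb; apply: ne; rewrite ea eb.
  exists (c * (x 0 (lo k) * x' 0 (hi k))); split; first by rewrite !mulf_neq0.
  move=> _ i j; rewrite AE; split.
    rewrite mulf_eq0 negb_or => /andP[_ ne].
    have [xx0|/prod_le[]] := eqVneq (x 0 i * x' 0 j) 0; last by move=> ? ?; apply: leq_add.
    by move: ne; rewrite xx0 sub0r oppr_eq0 mulrC => /prod_le[? ?]; rewrite addnC leq_add.
  move=> le_ij; have le_ji : (lo k + hi k <= j + i)%N by rewrite [(j + i)%N]addnC.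
  rewrite (prod_lead i j) // [x' 0 i * _]mulrC (prod_lead j i) //.
  by rewrite [(j == lo k) && (i == hi k)]andbC -mulrBr -[RHS]mulrA.
have [c cP] := choice lead.
have c0 k : c k != 0 by have [] := cP k.
have sum_e (i : 'I_#|I|) : (\sum_k e k * ((lo k == i) + (hi k == i)) = 2)%N.
  apply/eqP; rewrite -(eqr_nat R) natr_sum -(sum_p i) //; apply/eqP.
  apply: eq_bigr => k _; rewrite natrM pE mulrC.
  have [->|e0] := eqVneq (e k) 0%N; first by rewrite !mulr0n ?mul0r ?mulr0.
  by rewrite stepE.
have lo_neq_hi k : e k != 0%N -> lo k != hi k by move/lo_hi; rewrite -val_eqE neq_ltn => ->.
have [z zG] : exists z, z \in msupp (\det (blowup_mx 2 (graph_mx lo hi c e))).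
  by eexists; apply: mlead_supp; apply: graph_det_neq0.
exists I, z; split.
  have Fu : F \in unitmx by rewrite unitmx_inv.
  have FTu : F^T \in unitmx by rewrite unitmx_tr.
  rewrite -(@msupp_blowup_conj _ _ _ 2 (submatrices I) _ _ FTu Fu z).
  apply: graph_component zG => k i j e0; have [_ /(_ e0 i j)[]] := cP k; first by [].
  by move=> _ lead_eq /lead_eq ->; rewrite /graph_mx (negbTE e0) !mxE.
(* It remains to see that half the degrees satisfy the equations of [p]. *)
have deg0 k : p 0 k = 0 -> block_degree R z k = 0.
  move=> pk; pose w (j : 'I_m) : R := (j == k)%:R.
  have wE j : e j != 0%N -> w j = 0 + 0.
    move=> ej; rewrite addr0 /w (_ : j == k = false) //; apply: contraNF ej => /eqP ->.
    by rewrite -[_ == _]negbK e_neq0 pk eqxx.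
  have := graph_weight (lev := fun=> 0) wE zG.
  rewrite [X in _ = 4 * X]big1 // mulr0 (bigD1 k) //= /w eqxx mul1r => wz; rewrite -[RHS]wz.
  by rewrite big1 ?addr0 // => j /negbTE ->; rewrite mul0r.
pose y : 'rV[R]_m := \row_k (2^-1 * block_degree R z k - p 0 k).
suff /rowP yz : y = 0.
  move=> k; have := yz k; rewrite !mxE => /eqP; rewrite subr_eq0 => /eqP <-.
  by rewrite mulrA divff ?mul1r ?pnatr_eq0.
apply: inj_p => [k pk|i lt_ir]; first by rewrite mxE deg0 // pk mulr0 subrr.
under eq_bigr do rewrite mxE mulrBr.
rewrite sumrB sum_p //.
pose w k : R := if e k == 0%N then 0 else (step u v S i k)%:R.
pose lev (j : 'I_#|I|) : R := (j == Ordinal lt_ir)%:R.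
have wE k : e k != 0%N -> w k = lev (lo k) + lev (hi k).
  by move=> ek; rewrite /w (negbTE ek) stepE // natrD.
have := graph_weight wE zG.
rewrite [X in _ = 4 * X](bigD1 (Ordinal lt_ir)) //=.
rewrite [X in 4 * (_ + X)]big1 => [|j /negbTE jE]; last first.
  by rewrite /lev jE.
rewrite addr0 {1}/lev eqxx mulr1 => wz.
rewrite (eq_bigr (fun k => 2^-1 * (w k * block_degree R z k))) => [|k _]; last first.
  rewrite mulrCA /w; case: ifP => // /eqP ek.
  by rewrite deg0 ?mulr0 // pE ek.
by rewrite -mulr_sumr wz; field.
Qed.

End ExtremeExponent.

(** * Convex hulls of the exponents *)

Lemma conv_convex (R : realFieldType) m (S : set 'rV[R]_m) x y t :
  0 <= t <= 1 -> conv S x -> conv S y -> conv S (t *: x + (1 - t) *: y).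
Proof.
case/andP=> t0 t1 [N [w [a [w0 w1 Sa ->]]]] [N' [w' [a' [w'0 w'1 Sa' ->]]]].
exists (N + N')%N.
exists (fun i => match split i with inl j => t * w j | inr j => (1 - t) * w' j end).
exists (fun i => match split i with inl j => a j | inr j => a' j end).
split.
- by move=> i; case: split => j; rewrite mulr_ge0 ?subr_ge0.
- rewrite big_split_ord /= (eq_bigr (fun j => t * w j)) => [|j _].
    rewrite [X in _ + X](eq_bigr (fun j => (1 - t) * w' j)) => [|j _].
      by rewrite -!mulr_sumr w1 w'1; ring.
    by rewrite (unsplitK (inr j)).
  by rewrite (unsplitK (inl j)).
- by move=> i; case: split.
rewrite big_split_ord /= !scaler_sumr; congr (_ + _); apply: eq_bigr => j _.
  by rewrite (unsplitK (inl j)) scalerA.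
by rewrite (unsplitK (inr j)) scalerA.
Qed.

Lemma conv_mono (R : realFieldType) m (S T : set 'rV[R]_m) :
  (forall x, S x -> T x) -> forall x, conv S x -> conv T x.
Proof.
move=> ST x [N [w [a [w0 w1 Sa ->]]]]; exists N, w, a; split=> // i.
exact/ST.
Qed.

Lemma conv_point (R : realFieldType) m (S : set 'rV[R]_m) x : S x -> conv S x.
Proof.
move=> Sx; exists 1%N, (fun=> 1), (fun=> x); split=> //.
  by rewrite big_ord1.
by rewrite big_ord1 scale1r.
Qed.

Lemma conv_min (R : realFieldType) m (S : set 'rV[R]_m) (Q : 'rV[R]_m -> Prop) :
    (forall x y t, 0 <= t <= 1 -> Q x -> Q y -> Q (t *: x + (1 - t) *: y)) ->
    (forall x, S x -> Q x) -> forall x, conv S x -> Q x.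
Proof.
move=> Qconv SQ x [N [w [a [w0 w1 Sa ->]]]].
have {Sa} Qa i : Q (a i) by apply: SQ.
elim: N w a w0 w1 Qa => [|N IHN] w a w0 w1 Qa.
  by move/eqP: w1; rewrite big_ord0 eq_sym oner_eq0.
rewrite big_ord_recl; rewrite big_ord_recl in w1.
have w1E : \sum_(i < N) w (lift ord0 i) = 1 - w ord0 by rewrite -w1; ring.
have [w01|w01] := eqVneq (w ord0) 1.
  rewrite w01 subrr in w1E; rewrite w01 scale1r big1 ?addr0 // => i _.
  have /eqP := @psumr_eq0P _ _ predT _ (fun i _ => w0 (lift ord0 i)) w1E i isT.
  by move=> /eqP ->; rewrite scale0r.
have rest0 : 1 - w ord0 != 0 by rewrite subr_eq0 eq_sym.
have le1 : w ord0 <= 1 by rewrite -subr_ge0 -w1E sumr_ge0.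
rewrite (_ : \sum_(i < N) _ = (1 - w ord0) *:
  \sum_(i < N) (w (lift ord0 i) / (1 - w ord0)) *: a (lift ord0 i)).
  apply: Qconv; [by rewrite w0 le1|exact: Qa|].
  apply: (IHN (fun i => w (lift ord0 i) / (1 - w ord0)) (fun i => a (lift ord0 i))) => //.
    by move=> i; rewrite divr_ge0 // subr_ge0.
  by rewrite -mulr_suml w1E divff.
rewrite scaler_sumr; apply: eq_bigr => i _; rewrite scalerA; congr (_ *: _).
by rewrite mulrCA divff ?mulr1.
Qed.

(** * The blow-ups of a family of lines *)

Lemma castmx_tens (F : pzRingType) a a' b b' d (ha : a = a') (hb : b = b')
    (M : 'M[F]_(a, b)) (X : 'M[F]_d) :
  castmx (congr1 (muln^~ d) ha, congr1 (muln^~ d) hb) (tensmx M X) =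
  tensmx (castmx (ha, hb) M) X.
Proof. by case: a' / ha; case: b' / hb; rewrite !castmx_id. Qed.

Lemma castmx_sum (V : nmodType) (I : finType) a a' b b' (ab : (a = a') * (b = b'))
    (F : I -> 'M[V]_(a, b)) :
  castmx ab (\sum_i F i) = \sum_i castmx ab (F i).
Proof.
case: ab => ha hb; case: a' / ha; case: b' / hb; rewrite castmx_id.
by apply: eq_bigr => i _; rewrite castmx_id.
Qed.

(** The cast of a blow-up is the blow-up of the cast matrices, so the index
    sets of cardinality [l] can be replaced by maps from ['I_l]. *)
Lemma blowup_detE (K : fieldType) m n (A : 'I_m -> 'M[K]_n) (I J : {set 'I_n})
    d l (hI : #|I| = l) (hJ : #|J| = l) :
  blowup_det A d hI hJ = \det (blowup_mx d (fun k =>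
    mxsub (fun i => enum_val (cast_ord (esym hI) i))
          (fun j => enum_val (cast_ord (esym hJ) j)) (A k))).
Proof.
rewrite /blowup_det /blowup /blowup_mx; congr (\det _).
rewrite castmx_sum; apply: eq_bigr => k _.
rewrite castmx_tens; congr (tensmx _ _).
by apply/matrixP => i j; rewrite castmxE !mxE.
Qed.

Section LineFamily.

Variables (R : realFieldType) (K : fieldType) (m n : nat) (u v : 'I_m -> 'cV[K]_n).

Local Notation u' := (fun k => (u k)^T).
Local Notation v' := (fun k => (v k)^T).
Local Notation A := (line_mx u v).

Lemma line_mxE k : A k = alt_mx (u' k) (v' k).
Proof. by rewrite /line_mx /alt_mx !trmxK. Qed.

Lemma blowup_projE d (z : 'X_{1..blowup_nvars m d}) k :
  blowup_proj R z 0 k = d%:R^-1 * block_degree R z k.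
Proof. by rewrite mxE. Qed.

Lemma Sset_polytope d l x : (0 < d)%N -> Sset R A d l x -> line_polytope u' v' x.
Proof.
move=> d0 [I [J [hI [hJ [z]]]]]; rewrite blowup_detE => zA ->.
have dR : (0 : R) < d%:R by rewrite ltr0n.
split=> [k|S]; first by rewrite blowup_projE mulr_ge0 // invr_ge0 ltW.
have -> : qdot u' v' S (blowup_proj R z) =
    d%:R^-1 * \sum_k (line_rank u' v' S k)%:R * block_degree R z k.
  rewrite mulr_sumr; apply: eq_bigr => k _.
  by rewrite blowup_projE mulrCA.
rewrite ler_pdivrMl //; apply: blowup_degree_bound.
rewrite (_ : A = fun k => alt_mx (u' k) (v' k)) in zA; first exact: zA.
by apply/funext => k; apply: line_mxE.
Qed.

Hypothesis rank_line : forall k, \rank (u' k + v' k)%MS = 2.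

Lemma extreme_Sset p : line_polytope u' v' p -> extreme u' v' p ->
  exists2 l, (l <= n)%N & Sset R A 2 l p.
Proof.
move=> Pp ext; have [I [z [zA zp]]] := extreme_exponent rank_line Pp ext.
exists #|I|; first by rewrite -[n in leqRHS]card_ord max_card.
exists I, I, erefl, erefl, z.
  rewrite blowup_detE; move: zA; congr (is_true (z \in msupp (\det (blowup_mx 2 _)))).
  apply/funext => k; rewrite line_mxE; apply/matrixP => i j.
  by rewrite !mxE !cast_ord_id.
by apply/rowP => k; rewrite blowup_projE zp mulKf ?pnatr_eq0.
Qed.

Lemma polytope_Pd p : line_polytope u' v' p -> Pd R A 2 p.
Proof.
apply: (line_polytope_ind rank_line) => [x y t|q Pq ext]; first exact: conv_convex.
by apply: conv_point; have [l ln Sl] := extreme_Sset Pq ext; exists l.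
Qed.

Lemma Qset_polytope p : Qset R A p -> line_polytope u' v' p.
Proof.
apply: conv_min => [x y t|x [d d0 [l _]]]; first exact: line_polytope_convex.
exact: Sset_polytope.
Qed.

End LineFamily.

Lemma basis_rank (K : fieldType) n (L : {vspace 'cV[K]_n}) (a b : 'cV[K]_n) :
  basis_of L [:: a; b] -> \rank (a^T + b^T)%MS = 2.
Proof.
move/basis_free; rewrite free_cons span_seq1 => /andP[a_b b0].
apply/eqP; rewrite eqn_leq rank_addsmx_rV /=.
rewrite seq1_free in b0.
have rb : \rank b^T = 1%N by rewrite rank_rV trmx_eq0 b0.
suff : (b^T < a^T + b^T)%MS by rewrite ltmxErank rb => /andP[].
rewrite ltmxE addsmxSr; apply: contra a_b; rewrite addsmx_sub => /andP[/sub_rVP[c ab] _].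
by apply/vlineP; exists c; rewrite -[a]trmxK ab linearZ /= trmxK.
Qed.

Theorem theorem3p13 (R : realFieldType) (K : fieldType) (m n : nat)
    (L : 'I_m -> {vspace 'cV[K]_n}) (u v : 'I_m -> 'cV[K]_n)
    (dimL : forall k, (\dim (L k) = 2)%N)
    (basisL : forall k, basis_of (L k) [:: u k; v k]) :
  Pd R (line_mx u v) 2 = Ple R (line_mx u v) 2 /\
  Ple R (line_mx u v) 2 = Qset R (line_mx u v).
Proof.
have rank_line k : \rank ((u k)^T + (v k)^T)%MS = 2 := basis_rank (basisL k).
have QP x : Qset R (line_mx u v) x -> Pd R (line_mx u v) 2 x.
  by move/Qset_polytope; apply: polytope_Pd.
have PL x : Pd R (line_mx u v) 2 x -> Ple R (line_mx u v) 2 x.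
  by apply: conv_mono => y [l ln Sl]; exists 2; last by exists l.
have LQ x : Ple R (line_mx u v) 2 x -> Qset R (line_mx u v) x.
  by apply: conv_mono => y [f /andP[f1 _] Sf]; exists f.
by split; apply/seteqP; split=> x; auto.
Qed.
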